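(* Let $G$ be a finite plane bipartite graph which is elementary or weakly elementary, let $M$ be a perfect matching of $G$, and let $f$ be a proper $M$-alternating cell of $G$. \begin{enumerate} \item If $G$ has no improper $M$-alternating cell (equivalently, $M$ is the top element of $\mathcal{M}(G)$), then every proper $M$-alternating cell is a meet-irreducible cell with respect to $M$. \item If $G$ has at least one improper $M$-alternating cell, then the following are equivalent: \begin{enumerate} \item $f$ is a meet-irreducible cell with respect to $M$; \item $f$ shares at least one vertex with every improper $M$-alternating cell of $G$; \item there is no perfect matching $M'\in V(\mathcal{Q})\setminus\{M\}$ such that $f$ is a proper $M'$-alternating cell, where $\mathcal{Q}$ is the hypercube generated by all improper $M$-alternating cells, i.e. if $g_1,\dots,g_r$ are all the improper $M$-alternating cells of $G$ (they are pairwise vertex-disjoint), then $V(\mathcal{Q})=\{M\oplus \bigcup_{i\in S}E(g_i): S\subseteq\{1,\dots,r\}\}$. \end{enumerate} \end{enumerate}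
   Context: All graphs are finite. Let $G$ be a plane bipartite graph with a perfect matching whose vertices are properly colored black and white. A cell is an inner face of $G$ whose boundary is a cycle; the cell is identified with that cycle. For a perfect matching $M$ and an $M$-alternating cycle $C$, $M\oplus C$ denotes the symmetric difference of $M$ and $E(C)$, which is again a perfect matching. An $M$-alternating cycle $C$ is proper if, traversing $C$ in the clockwise direction, every edge of $C$ belonging to $M$ goes from its white end to its black end; otherwise it is improper. $\mathcal{M}(G)$ is the set of perfect matchings of $G$. The $Z$-transformation digraph $\vec{Z}(G)$ has vertex set $\mathcal{M}(G)$ and an arc from $M_1$ to $M_2$ iff $M_1\oplus M_2$ is the edge set of a cell which is a proper $M_1$-alternating (hence improper $M_2$-alternating) cycle. Define $M_1\le M_2$ iff $\vec{Z}(G)$ has a directed path from $M_2$ to $M_1$. $G$ is elementary if it is connected and every edge lies in some perfect matching. A cycle $C$ is nice if $G-V(C)$ has a perfect matching; $G$ is weakly elementary if for every nice cycle $C$, the subgraph consisting of $C$ together with its interior is elementary. For such $G$ (elementary or weakly elementary), $(\mathcal{M}(G),\le)$ is a finite distributive lattice whose Hasse diagram is $\vec{Z}(G)$. An element of a finite lattice is meet-irreducible if it is covered by exactly one element. A meet-irreducible cell with respect to $M$ is a proper $M$-alternating cell $f$ such that $M\oplus f$ is meet-irreducible in $\mathcal{M}(G)$. *)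

(* Defs.v *)
From HB Require Import structures.
From mathcomp Require Import all_boot perm.
From Stdlib Require Import Relation_Operators.

Set Implicit Arguments.
Unset Strict Implicit.
Unset Printing Implicit Defensive.

(* A finite graph drawn on an oriented surface, described combinatorially; the
   surface is the plane under the predicate [planar] below, which also excludes
   isolated vertices.  A dart is an edge together with one of its two
   directions, [flip] reverses the direction, and an edge is the pair of its
   darts.  [ccw] sends a dart to the next one, counterclockwise, around its
   source, and [rface d] is the face to the right of [d].  Following the
   boundary of a face with that face on the right, [d] is succeeded by
   [ccw (flip d)]; hence an inner face bounded by a cycle is traversed
   clockwise.  When the graph is not connected a face may have several boundary
   walks, which is why the faces are not defined as orbits. *)
Record drawing := Drawing {
  vertex : finType;
  dart : finType;
  face : finType;
  src : dart -> vertex;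
  flip : dart -> dart;
  ccw : {perm dart};
  rface : dart -> face;
  outer : face;
  flipK : involutive flip;
  flip_neq : forall d, flip d != d;
  ccwP : forall d d', (d' \in porbit ccw d) = (src d' == src d);
  rfaceP : forall d, rface (ccw (flip d)) = rface d
}.

Section Graph.
Variable G : drawing.
Implicit Types (u v : vertex G) (d : dart G) (f g : face G).

Definition tgt d : vertex G := src (flip d).
Definition edge d : {set dart G} := [set d; flip d].
Definition edges : {set {set dart G}} := [set edge d | d : dart G].
Definition ends (e : {set dart G}) : {set vertex G} := [set src d | d in e].
Definition verts (H : {set {set dart G}}) : {set vertex G} :=
  \bigcup_(e in H) ends e.

Definition adj (H : {set {set dart G}}) : rel (vertex G) :=
  [rel u v | [exists d, [&& edge d \in H, src d == u & tgt d == v]]].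

Definition incidence : rel (vertex G + face G)%type :=
  fun x y => match x, y with
  | inl v, inr f | inr f, inl v => [exists d, (src d == v) && (rface d == f)]
  | _, _ => false
  end.

(* If k is the number of connected components, w the number of boundary walks
   and s the sum of the genera of the components, then |V| - |E| + w = 2k - 2s,
   and connectedness of the incidence graph of the components and the faces
   gives w >= k + |F| - 1.  So the equation below says that s = 0 and that this
   incidence graph is a tree, i.e. that the drawing is one in the plane. *)
Definition planar : Prop :=
  (forall x y, connect incidence x y) /\
  #|vertex G| + #|face G| = #|edges| + n_comp (adj edges) predT + 1.

(* (W, H) stands for the subgraph with vertex set W and edge set H. *)
Definition perfect_matching_of (W : {set vertex G}) (H M : {set {set dart G}})
  : Prop :=
  M \subset H /\ forall v, v \in W -> #|[set e in M | v \in ends e]| = 1.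

Definition elementary_sub (W : {set vertex G}) (H : {set {set dart G}})
  : Prop :=
  (forall u v, u \in W -> v \in W -> connect (adj H) u v) /\
  (forall e, e \in H -> exists2 M, perfect_matching_of W H M & e \in M).

Definition perfect_matching (M : {set {set dart G}}) : Prop :=
  perfect_matching_of [set: vertex G] edges M.

Definition elementary : Prop := elementary_sub [set: vertex G] edges.

Definition symdiff (A B : {set {set dart G}}) : {set {set dart G}} :=
  (A :\: B) :|: (B :\: A).

(* A cycle is listed by its successive darts; the last condition excludes the
   back-and-forth walk along a single edge. *)
Definition is_cycle (c : seq (dart G)) : Prop :=
  [/\ c != [::], cycle [rel d d' | src d' == tgt d] c,
      uniq (map (@src G) c) & uniq (map edge c)].

Definition cycle_edges (c : seq (dart G)) : {set {set dart G}} :=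
  [set e in map edge c].

Definition nice (c : seq (dart G)) : Prop :=
  let W := ~: verts (cycle_edges c) in
  exists M, perfect_matching_of W [set e in edges | ends e \subset W] M.

Definition dual_adj (C : {set {set dart G}}) : rel (face G) :=
  [rel f g |
    [exists d, [&& edge d \notin C, rface d == f & rface (flip d) == g]]].

(* The faces inside C are those not joined to the outer face by a curve
   avoiding C. *)
Definition inside (C : {set {set dart G}}) : pred (face G) :=
  fun f => ~~ connect (dual_adj C) (outer G) f.

Definition disc_edges (c : seq (dart G)) : {set {set dart G}} :=
  let C := cycle_edges c in C :|: [set edge d | d : dart G & inside C (rface d)].

Definition weakly_elementary : Prop :=
  forall c, is_cycle c -> nice c ->
    elementary_sub (verts (disc_edges c)) (disc_edges c).

Definition alternating (M : {set {set dart G}}) (c : seq (dart G)) : Prop :=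
  forall d, d \in c -> (edge (next c d) \in M) = (edge d \notin M).

Definition boundary f : {set {set dart G}} :=
  [set edge d | d : dart G & rface d == f].

Definition cell f : Prop :=
  f != outer G /\ exists2 c, is_cycle c & cycle_edges c = boundary f.

Definition alternating_cell (M : {set {set dart G}}) f : Prop :=
  cell f /\
  exists c, [/\ is_cycle c, cycle_edges c = boundary f & alternating M c].

Section Coloring.
Variable white : pred (vertex G).

Definition proper_coloring : Prop := forall d, white (tgt d) = ~~ white (src d).

(* The darts of the clockwise traversal of a cell are those having it on their
   right. *)
Definition proper_orientation (M : {set {set dart G}}) f : Prop :=
  forall d, rface d = f -> edge d \in M -> white (src d) /\ ~~ white (tgt d).

Definition proper_cell (M : {set {set dart G}}) f : Prop :=
  alternating_cell M f /\ proper_orientation M f.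

Definition improper_cell (M : {set {set dart G}}) f : Prop :=
  alternating_cell M f /\ ~ proper_orientation M f.

Definition Zarc (M1 M2 : {set {set dart G}}) : Prop :=
  [/\ perfect_matching M1, perfect_matching M2 &
      exists2 f, proper_cell M1 f & symdiff M1 M2 = boundary f].

Definition matching_le (M1 M2 : {set {set dart G}}) : Prop :=
  clos_refl_trans _ Zarc M2 M1.

Definition top_matching (M : {set {set dart G}}) : Prop :=
  perfect_matching M /\ forall N, perfect_matching N -> matching_le N M.

Definition covered_by (M1 M2 : {set {set dart G}}) : Prop :=
  [/\ perfect_matching M1, perfect_matching M2, matching_le M1 M2, M1 <> M2 &
      forall N, perfect_matching N -> matching_le M1 N -> matching_le N M2 ->
        N = M1 \/ N = M2].

Definition meet_irreducible (M : {set {set dart G}}) : Prop :=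
  perfect_matching M /\ exists! N, covered_by M N.

Definition meet_irreducible_cell (M : {set {set dart G}}) f : Prop :=
  proper_cell M f /\ meet_irreducible (symdiff M (boundary f)).

(* M' is a vertex of the hypercube generated by the improper M-alternating
   cells. *)
Definition improper_hypercube (M M' : {set {set dart G}}) : Prop :=
  exists2 S : {set face G}, forall g, g \in S -> improper_cell M g &
    M' = symdiff M (\bigcup_(g in S) boundary g).

End Coloring.

Definition share_vertex f g : Prop :=
  exists v, v \in verts (boundary f) /\ v \in verts (boundary g).

End Graph.

(* Main.v *)
(* Orient every edge from its white to its black end.  In the plane the
   difference of two perfect matchings is then a circulation, hence the
   coboundary of an integer function h on the faces, unique once h vanishes at
   the outer face.  Reversing an improper alternating cell f adds the indicator
   of f to the potential, so directed paths of the Z-transformation digraph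
   have nonnegative potentials and the covering relations are exactly the arcs.
   Two alternating cells of the same sign that share a vertex share the matching
   edge there and traverse it in the same direction, so they coincide.  Hence
   the upper covers of the symmetric difference of M and f, other than M itself,
   come from the improper M-alternating cells disjoint from f, which gives all the equivalences.

   What remains is that a matching without improper cells is the top element.
   The sets {h >= t} are regions whose whole frontier is improper alternating,
   and regions can be cut by the level sets of the potential of any matching.
   So on a minimal region all these potentials are constant and no matching can
   change an interior edge; as every edge can be changed (in G, or inside a
   frontier cycle if G is only weakly elementary), a minimal region has no
   interior edge and its faces are improper cells. *)

Require Import Defs.
From mathcomp Require Import all_boot perm all_order all_algebra.
From mathcomp Require Import zify ring.
From Stdlib Require Import Relation_Operators Operators_Properties.

Set Implicit Arguments.
Unset Strict Implicit.
Unset Printing Implicit Defensive.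

Import Order.TTheory GRing.Theory Num.Theory.

Lemma uniq_map_inj_in (T1 T2 : eqType) (f : T1 -> T2) (s : seq T1) :
  uniq (map f s) -> {in s &, injective f}.
Proof.
elim: s => //= a s IHs /andP[fa /IHs{}IHs] x y.
rewrite !inE => /predU1P[->|xs] /predU1P[->|ys] // fxy; last exact: IHs.
- by rewrite fxy map_f in fa.
by rewrite -fxy map_f in fa.
Qed.

(** * Darts, edges, vertices and boundaries of faces *)

Section Drawing.
Variable G : drawing.
Implicit Types (d : dart G) (v : vertex G) (M N : {set {set dart G}}).

Lemma edge_flip d : edge (flip d) = edge d.
Proof. by rewrite /edge flipK setUC. Qed.

Lemma edge_eq d d' : (edge d == edge d') = (d == d') || (d == flip d').
Proof.
apply/eqP/orP => [e | [/eqP-> | /eqP->]] //; last exact: edge_flip.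
by have: d \in edge d'; [rewrite -e !inE eqxx | rewrite !inE => /orP].
Qed.

Lemma edge_in_edges d : edge d \in edges G.
Proof. exact: imset_f. Qed.

Lemma tgt_flip d : tgt (flip d) = src d.
Proof. by rewrite /tgt flipK. Qed.

Lemma src_ccw d : src (ccw G d) = src d.
Proof. by apply/eqP; rewrite -ccwP -[ccw G d]/(aperm d (ccw G)) -{1}(expg1 (ccw G)) mem_porbit. Qed.

Lemma rface_ccw d : rface (ccw G d) = rface (flip d).
Proof. by rewrite -[RHS]rfaceP flipK. Qed.

(** By [ccwP] the darts at a vertex form a single orbit of [ccw]; this is induction by rotation
    around the vertex. *)
Lemma ccw_ind (P : dart G -> Prop) d : P d ->
  (forall e, src e = src d -> P e -> P (ccw G e)) ->
  forall e, src e = src d -> P e.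
Proof.
move=> Pd Pccw e /eqP; rewrite -ccwP => /porbitP[n ->].
suff: src ((ccw G ^+ n)%g d) = src d /\ P ((ccw G ^+ n)%g d) by case.
elim: n => [|n [es Pe]]; first by rewrite expg0 perm1.
by rewrite expgSr permM src_ccw; split=> //; apply: Pccw.
Qed.

Lemma mem_ends v d : (v \in ends (edge d)) = (v == src d) || (v == tgt d).
Proof. by rewrite /ends /edge imsetU !imset_set1 !inE. Qed.

Lemma vertsP v (H : {set {set dart G}}) : H \subset edges G ->
  reflect (exists2 d, src d = v & edge d \in H) (v \in verts H).
Proof.
move=> sH; apply: (iffP bigcupP) => [[e eH ve] | [d <- dH]]; last first.
  by exists (edge d); rewrite ?mem_ends ?eqxx.
have /imsetP[d _ De] := subsetP sH _ eH; subst e.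
move: ve; rewrite mem_ends => /orP[] /eqP->; first by exists d.
by exists (flip d); rewrite ?edge_flip.
Qed.

Lemma mem_symdiff (A B : {set {set dart G}}) e :
  (e \in symdiff A B) = (e \in A) (+) (e \in B).
Proof. by rewrite !inE; do 2!case: (_ \in _). Qed.

Lemma symdiffK (A B : {set {set dart G}}) : symdiff (symdiff A B) B = A.
Proof. by apply/setP=> e; rewrite !mem_symdiff addbK. Qed.

Lemma boundaryE d (f : face G) :
  (edge d \in boundary f) = (rface d == f) || (rface (flip d) == f).
Proof.
apply/imsetP/orP => [[d'] | [df|df]].
- rewrite inE => df' /eqP; rewrite edge_eq => /orP[]/eqP->; first by left.
  by right; rewrite flipK.
- by exists d; rewrite ?inE.
by exists (flip d); rewrite ?inE ?edge_flip.
Qed.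

Lemma boundary_sub (f : face G) : boundary f \subset edges G.
Proof. by apply/subsetP=> _ /imsetP[d _ ->]; apply: edge_in_edges. Qed.

Lemma boundary_vertP (f : face G) v :
  reflect (exists2 d, rface d = f & src d = v) (v \in verts (boundary f)).
Proof.
apply: (iffP (vertsP v (boundary_sub f))) => [[d <-] | [d df <-]].
  rewrite boundaryE => /orP[] /eqP df; first by exists d.
  (* When [f] is on the left of [d], it is on the right of the next dart around the same vertex. *)
  by exists (ccw G d); rewrite ?src_ccw ?rface_ccw.
by exists d => //; rewrite boundaryE df eqxx.
Qed.

Lemma share_vertexP (f g : face G) : reflect (share_vertex f g)
  [exists v, (v \in verts (boundary f)) && (v \in verts (boundary g))].
Proof.
by apply: (iffP existsP) => [[v /andP[]] | [v [fv gv]]]; exists v; rewrite ?fv.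
Qed.

Lemma cycle_edgesE (c : seq (dart G)) d :
  (edge d \in cycle_edges c) = (d \in c) || (flip d \in c).
Proof.
rewrite inE; apply/mapP/orP => [[d' d'c /eqP] | [dc|dc]].
- by rewrite edge_eq => /orP[]/eqP->; rewrite ?flipK; [left|right].
- by exists d.
by exists (flip d); rewrite ?edge_flip.
Qed.

Lemma is_cycle_uniq (c : seq (dart G)) : is_cycle c -> uniq c.
Proof. by case=> _ _ /map_uniq. Qed.

Lemma is_cycle_src_inj (c : seq (dart G)) : is_cycle c -> {in c &, injective (@src G)}.
Proof. by case=> _ _ uc _ d d' dc d'c; exact: (uniq_map_inj_in uc). Qed.

End Drawing.

(** * Potentials of circulations *)

Section Potential.
Variables (G : drawing) (white : pred (vertex G)).
Hypotheses (planarG : planar G) (whiteP : proper_coloring white).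
Implicit Types (d : dart G) (v : vertex G) (f : face G).
Local Open Scope ring_scope.

(** The incidence graph of vertices and faces is connected, even when [G] is not, and the faces
    around one vertex are linked by crossing its edges. So a property that crosses edges reaches
    every face. *)
Lemma face_ind (P : face G -> Prop) : P (outer G) ->
  (forall d, P (rface d) -> P (rface (flip d))) -> forall f, P f.
Proof.
move=> P0 Pflip f.
have Pvert v d : src d = v -> P (rface d) -> forall e, src e = v -> P (rface e).
  move=> dv Pd e ev; apply: (@ccw_ind G (fun e => P (rface e)) d) => //.
    by move=> e' _ /Pflip; rewrite rface_ccw.
  by rewrite dv.
pose Q (x : vertex G + face G) :=
  match x with inl v => forall e, src e = v -> P (rface e) | inr f => P f end.
suff: Q (inr f) by [].
have /connectP[p ep ->] := planarG.1 (inr (outer G)) (inr f).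
have: Q (inr (outer G)) by [].
elim: p (inr (outer G) : vertex G + face G)%type ep => //= y p IHp x /andP[xy /IHp{}IHp] Qx.
apply: IHp; case: x y xy Qx => [u|g] [v|h] //= /existsP[d /andP[/eqP du /eqP dg]].
  by move=> /(_ d du); rewrite dg.
by rewrite -dg => Pd; apply: Pvert Pd.
Qed.

Lemma white_flip d : white (src (flip d)) = ~~ white (src d).
Proof. exact: whiteP. Qed.

Lemma src_neq_tgt d : (src d == tgt d) = false.
Proof. by apply/eqP => e; have := whiteP d; rewrite -e; case: (white _). Qed.

Lemma flip_inj : injective (@flip G).
Proof. exact: inv_inj (@flipK G). Qed.

(** Each edge has exactly one dart with a white source; these darts index the edges in the matrices
    below. *)
Lemma card_edges : #|edges G| = #|{: {d : dart G | white (src d)}}|.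
Proof.
rewrite card_sig -(card_in_imset (f := @edge G)) => [|d d'].
  apply/eq_card => e; apply/imsetP/imsetP => [[d _ ->]|[d _ ->]]; last by exists d.
  have [wd|bd] := boolP (white (src d)); first by exists d.
  by exists (flip d); rewrite ?edge_flip ?inE ?white_flip.
rewrite !inE => wd wd' /eqP; rewrite edge_eq => /orP[] /eqP // e.
by move: wd; rewrite e white_flip wd'.
Qed.

(** Rotating by [ccw] turns the faces to the left of the darts at [v] into those to the right, so
    the two sums cancel. *)
Lemma sum_coboundary (R : zmodType) (h : face G -> R) v :
  \sum_(d | src d == v) (h (rface d) - h (rface (flip d))) = 0.
Proof.
rewrite sumrB; apply/eqP; rewrite subr_eq0; apply/eqP.
rewrite (reindex_inj (@perm_inj _ (ccw G))) /=.
by apply: eq_big => d; rewrite ?src_ccw ?rface_ccw.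
Qed.

Lemma sum_over_edges (R : zmodType) (w : dart G -> R) v :
  (forall d, w (flip d) = - w d) ->
  \sum_(d | src d == v) w d =
  \sum_(d | white (src d)) (w d *+ (src d == v) - w d *+ (tgt d == v)).
Proof.
move=> wN; rewrite (bigID (fun d => white (src d))) /= sumrB; congr (_ + _).
  rewrite (eq_bigl (fun d => white (src d) && (src d == v))) => [|d]; last exact: andbC.
  by rewrite big_mkcondr /=; apply: eq_bigr => d _; case: eqP.
rewrite (reindex_inj flip_inj) /= -sumrN.
rewrite (eq_bigl (fun d => white (src d) && (tgt d == v))).
  by rewrite big_mkcondr /=; apply: eq_bigr => d _; case: eqP; rewrite ?oppr0 ?wN.
by move=> d; rewrite white_flip negbK andbC.
Qed.

Local Notation WD := {d : dart G | white (src d)}.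

(** With edges oriented from white to black, the left kernel of [incmx] is the space of circulations
    and the row space of [cobmx] that of the coboundaries of functions on faces. *)
Let incmx : 'M[rat]_(#|{: WD}|, #|vertex G|) := \matrix_(i, j)
  ((src (val (enum_val i)) == enum_val j)%:R -
   (tgt (val (enum_val i)) == enum_val j)%:R).
Let cobmx : 'M[rat]_(#|face G|, #|{: WD}|) := \matrix_(i, j)
  ((rface (val (enum_val j)) == enum_val i)%:R -
   (rface (flip (val (enum_val j))) == enum_val i)%:R).

Let dartrow (w : dart G -> rat) : 'rV[rat]_#|{: WD}| := \row_i w (val (enum_val i)).

Lemma dartrow_mulD w : (forall d, w (flip d) = - w d) ->
  dartrow w *m incmx = \row_j \sum_(d | src d == enum_val j) w d.
Proof.
move=> wN; apply/rowP => j; rewrite !mxE (sum_over_edges _ wN).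
rewrite (reindex_omap (val : WD -> _) insub) /=; last first.
  by move=> d wd; rewrite insubT /=.
rewrite (reindex (fun i : 'I_#|{: WD}| => enum_val i)) /=; last first.
  by exists enum_rank => i _; rewrite ?enum_valK ?enum_rankK.
rewrite [RHS]big_mkcond /=; apply: eq_bigr => i _; rewrite !mxE.
rewrite (valP (enum_val i)) valK eqxx /=.
by rewrite mulrBr !mulr_natr.
Qed.

Lemma sum_enum_val (T : finType) (u : 'I_#|T| -> rat) (t : T) :
  \sum_i u i * (t == enum_val i)%:R = u (enum_rank t).
Proof.
rewrite (bigD1 (enum_rank t)) //= enum_rankK eqxx mulr1 big1 ?addr0 // => i ni.
by rewrite -(inj_eq enum_rank_inj) enum_valK eq_sym (negbTE ni) mulr0.
Qed.

Lemma row_mulB (u : 'rV[rat]_#|face G|) :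
  u *m cobmx = dartrow (fun d => u 0 (enum_rank (rface d)) - u 0 (enum_rank (rface (flip d)))).
Proof.
apply/rowP => j; rewrite !mxE; under eq_bigr do rewrite mxE mulrBr.
by rewrite sumrB !(sum_enum_val (u 0)).
Qed.

Lemma row_mulDtr (u : 'rV[rat]_#|vertex G|) :
  u *m incmx^T = dartrow (fun d => u 0 (enum_rank (src d)) - u 0 (enum_rank (tgt d))).
Proof.
apply/rowP => j; rewrite !mxE; under eq_bigr do rewrite !mxE mulrBr.
by rewrite sumrB !(sum_enum_val (u 0)).
Qed.

Lemma dartrow_eq0 w d : (forall d, w (flip d) = - w d) -> dartrow w = 0 -> w d = 0.
Proof.
move=> wN /rowP w0; wlog wd : d / white (src d) => [IH|].
  have [/IH // | bd] := boolP (white (src d)).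
  by apply: oppr_inj; rewrite oppr0 -wN IH // white_flip.
by have := w0 (enum_rank (exist _ d wd : WD)); rewrite !mxE enum_rankK.
Qed.

Lemma adj_sym (H : {set {set dart G}}) : connect_sym (adj H).
Proof.
apply: sym_connect_sym => u v; apply/existsP/existsP => -[d /and3P[dH du dv]];
  by exists (flip d); rewrite edge_flip tgt_flip dH du dv.
Qed.

(** A vertex function killed by [incmx^T] is constant on components, hence determined by its values
    at their roots; so the kernel has dimension at most the number of components. *)
Lemma rank_incidence : (#|vertex G| <= \rank incmx + n_comp (adj (edges G)) predT)%N.
Proof.
pose K := kermx incmx^T; rewrite -mxrank_tr -leq_subLR -mxrank_ker -/K.
pose A := [predI roots (adj (edges G)) & predT].
pose K' : 'M[rat]_(#|vertex G|, #|A|) := \matrix_(i, r) K i (enum_rank (enum_val r)).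
pose S : 'M[rat]_(#|A|, #|vertex G|) :=
  \matrix_(r, j) (enum_val r == fingraph.root (adj (edges G)) (enum_val j))%:R.
suff ->: K = K' *m S by apply: leq_trans (mxrankM_maxr _ _) (rank_leq_row _).
apply/matrixP => i j; rewrite [RHS]mxE.
under eq_bigr do rewrite [K' _ _]mxE [S _ _]mxE.
set r := fingraph.root _ _.
rewrite -(@big_enum_val _ _ _ _ A (fun x => K i (enum_rank x) * (x == r)%:R)) /=.
have rA : r \in A by rewrite !inE roots_root //; apply: adj_sym.
rewrite (bigD1 r) //= eqxx mulr1 big1 ?addr0 => [|x /andP[_ /negbTE->]]; last by rewrite mulr0.
have Kstep d : K i (enum_rank (src d)) = K i (enum_rank (tgt d)).
  have: row i K *m incmx^T = 0 by apply/sub_kermxP/row_sub.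
  rewrite row_mulDtr => /(@dartrow_eq0 _ d) H; apply/eqP; rewrite -subr_eq0.
  apply/eqP; rewrite ![row _ _ _ _]mxE in H; apply: H => d'.
  by rewrite tgt_flip opprB.
have /connectP[p] := connect_root (adj (edges G)) (enum_val j); rewrite -/r => ep ->.
rewrite -[in LHS](enum_valK j).
elim: p (enum_val j) ep => //= y p IHp x /andP[/existsP[d /and3P[_ /eqP<- /eqP<-]] /IHp <-].
exact: Kstep.
Qed.

(** By [face_ind] a function with zero coboundary is determined by its value at the outer face, so
    the kernel has dimension at most one. *)
Lemma rank_coboundary : (#|face G| <= (\rank cobmx).+1)%N.
Proof.
pose K := kermx cobmx; rewrite -addn1 -leq_subLR -mxrank_ker -/K.
pose o := enum_rank (outer G).
suff ->: K = col o K *m const_mx 1 by apply: leq_trans (mxrankM_maxr _ _) (rank_leq_row _).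
apply/matrixP => i j; rewrite [RHS]mxE big_ord1.
rewrite ![col _ _ _ _]mxE [const_mx _ _ _]mxE mulr1 -(enum_valK j).
elim/face_ind: (enum_val j) => // d <-.
have: row i K *m cobmx = 0 by apply/sub_kermxP/row_sub.
rewrite row_mulB => /(@dartrow_eq0 _ d) H; apply/esym/eqP; rewrite -subr_eq0.
apply/eqP; rewrite ![row _ _ _ _]mxE in H; apply: H => d'.
by rewrite flipK opprB.
Qed.

(* By Euler's formula the coboundaries, which are circulations, span a space of
   the same dimension as the space of circulations. *)
Lemma circulation_rat (w : dart G -> rat) :
  (forall d, w (flip d) = - w d) -> (forall v, \sum_(d | src d == v) w d = 0) ->
  exists h : face G -> rat, forall d, w d = h (rface d) - h (rface (flip d)).
Proof.
move=> wN w0.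
have BD : cobmx *m incmx = 0.
  apply/row_matrixP => i; rewrite row_mul row0 rowE row_mulB.
  rewrite dartrow_mulD => [|d]; last by rewrite flipK opprB.
  apply/rowP => j; rewrite !mxE.
  exact: (sum_coboundary (fun f => delta_mx 0 i 0 (enum_rank f) : rat)).
have sB : (cobmx <= kermx incmx)%MS by apply/sub_kermxP.
have eB : (kermx incmx <= cobmx)%MS.
  rewrite -(mxrank_leqif_sup sB).2 eqn_leq mxrankS //= mxrank_ker.
  (* Euler's formula and the two rank bounds make the dimension [E - rD] of the space of
     circulations at most the rank [rB] of the coboundaries. *)
  have euler (V F E k rB rD : nat) :
      (V + F = E + k + 1 -> F <= rB.+1 -> V <= rD + k -> E - rD <= rB)%N by lia.
  apply: euler rank_coboundary rank_incidence.
  by have := planarG.2; rewrite card_edges.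
have: (dartrow w <= cobmx)%MS.
  apply: submx_trans eB; apply/sub_kermxP; rewrite dartrow_mulD //.
  by apply/rowP => j; rewrite !mxE w0.
case/submxP => u; rewrite row_mulB => e.
exists (fun f => u 0 (enum_rank f)) => d.
apply/eqP; rewrite -subr_eq0; apply/eqP.
pose k d := u 0 (enum_rank (rface d)) - u 0 (enum_rank (rface (flip d))).
apply: (@dartrow_eq0 (fun d => w d - k d) d) => [d'|]; rewrite /k.
  by rewrite wN flipK; ring.
by move/rowP: e => e; apply/rowP => i; have := e i; rewrite !mxE => ->; rewrite subrr.
Qed.

(** Normalised at the outer face, the rational potential changes by integers across edges, so
    [face_ind] makes it integral everywhere; [Num.floor] merely converts it to [int]. *)
Lemma circulation_potential (w : dart G -> int) :
  (forall d, w (flip d) = - w d) -> (forall v, \sum_(d | src d == v) w d = 0) ->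
  exists h : face G -> int,
    h (outer G) = 0 /\ forall d, w d = h (rface d) - h (rface (flip d)).
Proof.
move=> wN w0; have [d|v|h hE] := @circulation_rat (fun d => (w d)%:~R).
- by rewrite wN intrN.
- by rewrite -(rmorph_sum intr) w0.
pose k f := h f - h (outer G).
have kint f : k f = (Num.floor (k f))%:~R.
  apply/esym/eqP; rewrite -intrEfloor.
  elim/face_ind : f => [|d]; first by rewrite /k subrr.
  have -> : k (rface (flip d)) = k (rface d) - (w d)%:~R by rewrite hE /k; ring.
  by move=> kd; rewrite rpredB // intr_int.
exists (fun f => Num.floor (k f)); split=> [|d]; first by rewrite /k subrr floor0.
apply: (@intr_inj rat); rewrite intrB -!kint hE /k; ring.
Qed.

Lemma potential_const (h : face G -> int) :
  (forall d, h (rface d) = h (rface (flip d))) -> forall f, h f = h (outer G).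
Proof. by move=> hd; apply: face_ind => // d; rewrite hd. Qed.

End Potential.

(** * Matchings and signed faces *)

Section Matching.
Variables (G : drawing) (white : pred (vertex G)).
Hypotheses (planarG : planar G) (whiteP : proper_coloring white).
Implicit Types (d : dart G) (v : vertex G) (f g : face G).
Implicit Types (M N : {set {set dart G}}) (c : seq (dart G)) (s : bool).
Local Open Scope ring_scope.

Let white_flip := white_flip whiteP.

Lemma edge_src_inj d d' : src d = src d' -> edge d = edge d' -> d = d'.
Proof.
move=> e /eqP; rewrite edge_eq => /orP[]/eqP // e'.
by have := white_flip d'; rewrite -e' e; case: (white _).
Qed.

Lemma edge_of M e : M \subset edges G -> e \in M -> exists d, e = edge d.
Proof. by move=> /subsetP sM /sM /imsetP[d _ ->]; exists d. Qed.

Lemma card_ends M v : M \subset edges G ->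
  #|[set e in M | v \in ends e]| = (\sum_(d | src d == v) (edge d \in M))%N.
Proof.
move=> sM; rewrite -big_mkcondr /= sum1dep_card.
rewrite -(card_in_imset (f := @edge G)) => [|d d']; last first.
  by rewrite !inE => /andP[/eqP dv _] /andP[/eqP dv' _]; apply: edge_src_inj; rewrite dv.
apply/eq_card => e; rewrite inE; apply/andP/imsetP => [[eM ve]|[d]].
  have [d De] := edge_of sM eM; rewrite {}De in eM ve *; move: ve.
  rewrite mem_ends => /orP[]/eqP dv; first by exists d; rewrite // inE dv eqxx eM.
  by exists (flip d); rewrite ?edge_flip // !inE edge_flip eM dv eqxx.
by rewrite inE => /andP[/eqP<- dM] ->; rewrite mem_ends eqxx.
Qed.

Lemma matching_ex M v : perfect_matching M -> exists2 d, src d = v & edge d \in M.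
Proof.
case=> sM /(_ v (in_setT v)); rewrite card_ends // => s1.
case: (pickP (fun d => (src d == v) && (edge d \in M))) => [d /andP[/eqP]|no].
  by exists d.
by move: s1; rewrite big1 // => d dv; have := no d; rewrite dv => /= ->.
Qed.

Lemma matching_of_uniq W H M e e' v : perfect_matching_of W H M ->
  v \in W -> v \in ends e -> v \in ends e' -> e \in M -> e' \in M -> e = e'.
Proof.
move=> [_ M1] vW ve ve' eM e'M; have /eqP/cards1P[x Ex] := M1 v vW.
have: e \in [set e in M | v \in ends e] by rewrite inE eM.
have: e' \in [set e in M | v \in ends e] by rewrite inE e'M.
by rewrite Ex !inE => /eqP-> /eqP->.
Qed.

Lemma matching_uniq M d d' : perfect_matching M -> src d = src d' ->
  edge d \in M -> edge d' \in M -> d = d'.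
Proof.
move=> pmM e dM d'M; apply: edge_src_inj => //.
by apply: (matching_of_uniq (v := src d) pmM) => //; rewrite mem_ends ?e eqxx.
Qed.

Definition sg v : int := if white v then 1 else -1.
(** The unit flow along the edges of [M] from white to black; for a perfect matching its divergence
    at [v] is [sg v]. *)
Definition flux M d : int := sg (src d) * (edge d \in M)%:Z.
(* [h] is the potential of [N] relative to [M]. *)
Definition compat M N (h : face G -> int) : Prop :=
  forall d, flux N d - flux M d = h (rface d) - h (rface (flip d)).

Lemma flux_flip M d : flux M (flip d) = - flux M d.
Proof. by rewrite /flux /sg white_flip edge_flip; case: (white _); rewrite /=; ring. Qed.

Lemma sum_flux M v :
  \sum_(d | src d == v) flux M d = sg v * (\sum_(d | src d == v) (edge d \in M))%N%:Z.
Proof.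
rewrite (big_morph Posz PoszD (erefl _)) mulr_sumr.
by apply: eq_bigr => d /eqP; rewrite /flux => ->.
Qed.

Lemma matching_sum_flux M v : perfect_matching M -> \sum_(d | src d == v) flux M d = sg v.
Proof. by case=> sM /(_ v (in_setT v)); rewrite sum_flux card_ends // => ->; rewrite mulr1. Qed.

(** A coboundary has zero divergence, so [N] has the same flux sum as [M] at each vertex, that is,
    exactly one edge there. *)
Lemma compat_matching M N h : N \subset edges G ->
  perfect_matching M -> compat M N h -> perfect_matching N.
Proof.
move=> sN pmM cMN; split=> // v _; rewrite card_ends //; apply/eqP.
have: \sum_(d | src d == v) (flux N d - flux M d) = 0.
  by under eq_bigr do rewrite cMN; apply: sum_coboundary.
rewrite sumrB (matching_sum_flux v pmM) sum_flux; set k := (\sum_(_ | _) _)%N.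
by rewrite /sg; case: (white v) => e; lia.
Qed.

Lemma matching_potential M N : perfect_matching M -> perfect_matching N ->
  exists h : face G -> int, h (outer G) = 0 /\ compat M N h.
Proof.
move=> pmM pmN; apply: (circulation_potential planarG whiteP (w := fun d => flux N d - flux M d)).
  by move=> d; rewrite !flux_flip; ring.
by move=> v; rewrite sumrB !matching_sum_flux // subrr.
Qed.

Lemma flux_inj M N : M \subset edges G -> N \subset edges G ->
  (forall d, flux N d = flux M d) -> M = N.
Proof.
move=> sM sN e; have mem d : (edge d \in M) = (edge d \in N).
  by have := e d; rewrite /flux /sg; case: (white _); do 2!case: (_ \in _).
apply/setP => x; apply/idP/idP => xM.
  by have [d De] := edge_of sM xM; rewrite De -mem -De.
by have [d De] := edge_of sN xM; rewrite De mem -De.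
Qed.

(* Cells with [signed true] are the proper ones, those with [signed false] the
   improper ones; the condition alone does not say that [f] is a cell. *)
Definition signed s M f : Prop :=
  forall d, rface d = f -> (edge d \in M) = (white (src d) == s).

Lemma mem_bigcup_boundary (S : {set face G}) d :
  (edge d \in \bigcup_(f in S) boundary f) = (rface d \in S) || (rface (flip d) \in S).
Proof.
apply/bigcupP/orP => [[f fS]|[dS|dS]].
- by rewrite boundaryE => /orP[]/eqP->; [left|right].
- by exists (rface d); rewrite ?boundaryE ?eqxx.
by exists (rface (flip d)); rewrite ?boundaryE ?eqxx ?orbT.
Qed.

(** No edge has faces of the same sign on both sides, since its two darts start at opposite colours;
    hence reversing the union of the boundaries amounts to reversing the faces one by one. *)
Lemma compat_flip_faces s M (S : {set face G}) : (forall f, f \in S -> signed s M f) ->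
  compat M (symdiff M (\bigcup_(f in S) boundary f))
    (fun f => (if s then -1 else 1) * (f \in S)%:Z).
Proof.
move=> sS d; rewrite /flux mem_symdiff mem_bigcup_boundary.
have := sS (rface d); have := sS (rface (flip d)).
case: (rface d \in S); case: (rface (flip d) \in S) => /=.
- move=> /(_ isT (flip d) erefl) e1 /(_ isT d erefl) e2.
  by move: e1; rewrite edge_flip e2 white_flip; case: (white _); case: (s).
- move=> _ /(_ isT d erefl) ->; rewrite /sg.
  by case: (white _); case: (s).
- move=> /(_ isT (flip d) erefl); rewrite edge_flip white_flip => -> _; rewrite /sg.
  by case: (white _); case: (s).
by rewrite addbF subrr mulr0 subrr.
Qed.

Lemma sub_symdiff M (B : {set {set dart G}}) :
  M \subset edges G -> B \subset edges G -> symdiff M B \subset edges G.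
Proof.
move=> /subsetP sM /subsetP sB; apply/subsetP => e; rewrite !inE.
by case/orP => /andP[_]; [apply: sM|apply: sB].
Qed.

Lemma matching_flip_faces s M (S : {set face G}) : perfect_matching M ->
  (forall f, f \in S -> signed s M f) ->
  perfect_matching (symdiff M (\bigcup_(f in S) boundary f)).
Proof.
move=> pmM sS; apply: compat_matching (compat_flip_faces sS) => //.
apply: sub_symdiff; first by case: pmM.
by apply/bigcupsP => f _; apply: boundary_sub.
Qed.

Lemma compat_flip_face s M f : signed s M f ->
  compat M (symdiff M (boundary f)) (fun g => (if s then -1 else 1) * (g == f)%:Z).
Proof.
move=> sf d; have := @compat_flip_faces s M [set f].
rewrite big_set1 => -> => [|g]; last by rewrite inE => /eqP->.
by rewrite !inE.
Qed.

Lemma matching_flip_face s M f : perfect_matching M -> signed s M f ->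
  perfect_matching (symdiff M (boundary f)).
Proof.
move=> pmM sf; apply: compat_matching (compat_flip_face sf) => //.
by apply: sub_symdiff (boundary_sub f); case: pmM.
Qed.

Lemma signed_flip_faces s M (S : {set face G}) f : f \in S -> signed s M f ->
  signed (~~ s) (symdiff M (\bigcup_(f in S) boundary f)) f.
Proof.
move=> fS sf d df; rewrite mem_symdiff mem_bigcup_boundary df fS (sf _ df).
by case: (white _); case: (s).
Qed.

Lemma signed_flip_face s M f : signed s M f -> signed (~~ s) (symdiff M (boundary f)) f.
Proof. by have := @signed_flip_faces s M [set f] f; rewrite big_set1 inE eqxx; apply. Qed.

Lemma signed_disjoint s M f g : ~ share_vertex f g -> signed s M g ->
  signed s (symdiff M (boundary f)) g.
Proof.
move=> nfg sg d dg; rewrite mem_symdiff boundaryE -(sg _ dg).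
case: orP => [df|]; last by rewrite addbF.
case: nfg; exists (src d); split; apply/boundary_vertP; last by exists d.
case: df => /eqP df; first by exists d.
by exists (ccw G d); rewrite ?src_ccw ?rface_ccw.
Qed.

(* The matching edge at a common vertex lies on both faces, and since they have
   the same sign it is traversed in the same direction around both. *)
Lemma signed_share_eq s M f g : perfect_matching M ->
  signed s M f -> signed s M g -> share_vertex f g -> f = g.
Proof.
move=> pmM sf sg [v [/boundary_vertP[d df dv] /boundary_vertP[e eg ev]]].
have [wv|wv] := boolP (white v == s).
  have dM : edge d \in M by rewrite (sf _ df) dv.
  have eM : edge e \in M by rewrite (sg _ eg) ev.
  by rewrite -df -eg (matching_uniq pmM _ dM eM) // dv.
(* [pre d] is the dart before [d] on the boundary walk of its face. At a vertex of the other colour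
   the matching edge is the one by which the walk arrives. *)
pose pre d := flip ((ccw G)^-1%g d).
have rpre x : rface (pre x) = rface x by rewrite /pre -rface_ccw permKV.
have spre x : src (flip (pre x)) = src x by rewrite /pre flipK -src_ccw permKV.
have wpre x : white (src (pre x)) = ~~ white (src x) by rewrite -[in RHS]spre white_flip negbK.
have dM : edge (flip (pre d)) \in M.
  by rewrite edge_flip (sf _ (etrans (rpre d) df)) wpre dv; case: (white v) (s) wv => -[].
have eM : edge (flip (pre e)) \in M.
  by rewrite edge_flip (sg _ (etrans (rpre e) eg)) wpre ev; case: (white v) (s) wv => -[].
have e1 : flip (pre d) = flip (pre e).
  by apply: (matching_uniq pmM _ dM eM); rewrite !spre dv.
by rewrite -df -eg -rpre -(rpre e) (flip_inj e1).
Qed.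

End Matching.

(** * Cycles *)

Section Cycles.
Variables (G : drawing) (white : pred (vertex G)).
Hypotheses (planarG : planar G) (whiteP : proper_coloring white).
Implicit Types (d : dart G) (v : vertex G) (f g : face G).
Implicit Types (M N : {set {set dart G}}) (c : seq (dart G)) (s : bool).
Local Open Scope ring_scope.

Let white_flip := white_flip whiteP.

Lemma src_next c d : is_cycle c -> d \in c -> src (next c d) = tgt d.
Proof. by move=> [_ cc _ _] dc; apply/eqP; apply: (next_cycle cc dc). Qed.

Lemma cycle_flipN c d : is_cycle c -> d \in c -> flip d \notin c.
Proof.
move=> [_ _ _ uc] dc; apply/negP => fdc.
have := uniq_map_inj_in uc fdc dc (edge_flip d); apply/eqP.
exact: flip_neq.
Qed.

Lemma cycle_ind c (P : dart G -> Prop) : is_cycle c ->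
  (forall x, x \in c -> P x -> P (next c x)) ->
  forall x y, x \in c -> y \in c -> P x -> P y.
Proof.
move=> cc Pn x y xc yc Px; have uc := is_cycle_uniq cc.
have: fconnect (next c) x y by rewrite (fconnect_cycle (cycle_next uc) xc).
move/iter_findex <-; elim: (findex _ x y) => //= n IHn; apply: Pn => //.
by elim: (n) => //= m; rewrite mem_next.
Qed.

(** The signed indicator of a cycle is a circulation, as each vertex is left as often as it is
    entered. Its potential is a winding number and takes the place of the Jordan curve theorem. *)
Lemma cycle_potential c : is_cycle c -> exists h : face G -> int,
  h (outer G) = 0 /\
  forall d, (d \in c)%:Z - (flip d \in c)%:Z = h (rface d) - h (rface (flip d)).
Proof.
move=> cc; pose w d := (d \in c)%:Z - (flip d \in c)%:Z.
apply: (circulation_potential planarG whiteP (w := w)); rewrite /w.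
  by move=> d; rewrite flipK; ring.
move=> v; rewrite sumrB; apply/eqP; rewrite subr_eq0; apply/eqP.
have uc := is_cycle_uniq cc.
rewrite [RHS](reindex_inj (@flip_inj G)) /=; under [RHS]eq_bigr do rewrite flipK.
rewrite [LHS](reindex_inj (can_inj (prev_next uc))) /= big_mkcond [RHS]big_mkcond /=.
apply: eq_bigr => d _; rewrite mem_next.
by have [dc|_] := boolP (d \in c); [rewrite src_next // /tgt | rewrite !if_same].
Qed.

(** The potential of the cycle differs by one across each of its edges. *)
Lemma cycle_two_sided c d : is_cycle c -> edge d \in cycle_edges c ->
  rface d != rface (flip d).
Proof.
move=> cc; have [h [_ hE]] := cycle_potential cc.
rewrite cycle_edgesE => dc; apply: contraTneq dc => e.
have := hE d; rewrite e subrr; apply: contra_eqN => /orP[] dc.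
  by rewrite dc (negbTE (cycle_flipN cc dc)).
by have := cycle_flipN cc dc; rewrite flipK => /negbTE->; rewrite dc.
Qed.

Lemma cycle_consecutive c d d' : is_cycle c ->
  edge d \in cycle_edges c -> edge d' \in cycle_edges c -> src d' = tgt d ->
  edge d != edge d' ->
  (d \in c /\ d' = next c d) \/ (flip d' \in c /\ flip d = next c (flip d')).
Proof.
move=> cc; rewrite !cycle_edgesE => dC d'C sd; rewrite edge_eq negb_or => /andP[n1 n2].
have inj := is_cycle_src_inj cc; have uc := is_cycle_uniq cc.
case/orP: dC => dc; case/orP: d'C => d'c.
- by left; split=> //; apply: inj; rewrite ?mem_next ?src_next.
- case/eqP: n2; apply: (can_inj (prev_next uc)); apply: inj; rewrite ?mem_next //.
  by rewrite !src_next // tgt_flip.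
- by case/eqP: n2; rewrite -[d]flipK (inj _ _ dc d'c).
right; split=> //; apply: inj; rewrite ?mem_next //.
by rewrite src_next // tgt_flip.
Qed.

(** If [f] is on the right of [d], its boundary walk continues with [ccw (flip d)], another cycle
    edge at the head of [d], which must be [next c d]. So the side of [f] does not change along
    [c]. *)
Lemma cell_sides c f : is_cycle c -> cycle_edges c = boundary f ->
  (forall d, d \in c -> rface d = f) \/ (forall d, d \in c -> rface (flip d) = f).
Proof.
move=> cc Cf.
have bd d : d \in c -> (rface d == f) || (rface (flip d) == f).
  by move=> dc; rewrite -boundaryE -Cf cycle_edgesE dc.
have step d : d \in c -> rface d = f -> rface (next c d) = f.
  move=> dc df; pose e := ccw G (flip d).
  have ef : rface e = f by rewrite /e rfaceP.
  have se : src e = tgt d by rewrite src_ccw.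
  have dC : edge d \in cycle_edges c by rewrite cycle_edgesE dc.
  have eC : edge e \in cycle_edges c by rewrite Cf boundaryE ef eqxx.
  have nde : edge d != edge e.
    rewrite eq_sym edge_eq negb_or; apply/andP; split.
      by apply: contraFneq (src_neq_tgt whiteP d) => ed; rewrite -{1}ed se.
    (* Were the walk to turn back, [flip d] would be the only dart at its source, and [c] would
       backtrack. *)
    apply: contraNneq (cycle_flipN cc dc) => ed.
    have: next c d = flip d.
      apply: (@ccw_ind G (fun x => x = flip d) (flip d)) => // [x _ ->|].
        exact: ed.
      exact: src_next.
    by move=> <-; rewrite mem_next.
  have [[_ <-]|[ec fd]] // := cycle_consecutive cc dC eC se nde.
  by have := cycle_flipN cc dc; rewrite fd mem_next ec.
have [/hasP[x xc /eqP xf]|no] := boolP (has (fun d => rface d == f) c).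
  by left=> y yc; apply: (cycle_ind cc step xc yc xf).
right=> y yc; have := bd y yc.
by move/hasPn/(_ y yc): no => /negbTE-> /eqP.
Qed.

Lemma signed_alternating s M c f : is_cycle c -> cycle_edges c = boundary f ->
  signed white s M f -> alternating M c.
Proof.
move=> cc Cf sf d dc; have sn := src_next cc dc.
have nc : next c d \in c by rewrite mem_next.
have [rf|rf] := cell_sides cc Cf.
  by rewrite !(sf _ (rf _ _)) // sn /tgt white_flip; case: (white _); case: (s).
rewrite -edge_flip -(edge_flip d) !(sf _ (rf _ _)) // !white_flip sn /tgt white_flip.
by case: (white _); case: (s).
Qed.

(** Membership in [M] and the colour of the source both alternate along [c], so their exclusive or
    [t] is constant; together with the side of [f] it gives the sign. *)
Lemma alternating_signed M c f : is_cycle c -> cycle_edges c = boundary f ->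
  alternating M c -> exists s, signed white s M f.
Proof.
move=> cc Cf alt.
have c0 : has predT c by case: cc; case: (c).
have [d0 d0c _] := hasP c0.
pose t d := (edge d \in M) (+) white (src d).
have tc d : d \in c -> t d = t d0.
  move=> dc; apply: (cycle_ind cc (P := fun d => t d = t d0) _ d0c dc) => // x xc <-.
  by rewrite /t (alt _ xc) src_next // /tgt white_flip; case: (_ \in _); case: (white _).
have mem d : rface d = f -> (d \in c) || (flip d \in c).
  by move=> df; rewrite -cycle_edgesE Cf boundaryE df eqxx.
have two d : rface d = f -> rface (flip d) <> f.
  move=> df fdf; have := @cycle_two_sided c d cc; rewrite Cf boundaryE df fdf eqxx.
  by move=> /(_ isT).
have [rf|rf] := cell_sides cc Cf.
  exists (~~ t d0) => d df; have /orP[dc|/rf] := mem d df; last by move/two; rewrite flipK df.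
  by rewrite -(tc _ dc) /t; case: (_ \in _); case: (white _).
exists (t d0) => d df; have /orP[/rf|dc] := mem d df; first by move/(two _ df).
by rewrite -(tc _ dc) /t edge_flip white_flip; case: (_ \in _); case: (white _).
Qed.

Lemma signed_dart s M f d : rface d = f -> signed white s M f ->
  exists2 e, rface e = f & (edge e \in M) && (white (src e) == s).
Proof.
move=> df sf; have [wd|wd] := boolP (white (src d) == s).
  by exists d; rewrite ?(sf _ df) ?wd.
have ef : rface (ccw G (flip d)) = f by rewrite rfaceP.
exists (ccw G (flip d)) => //; rewrite (sf _ ef) src_ccw white_flip.
by case: (white _) (s) wd => -[].
Qed.

Lemma cell_dart f : cell f -> exists d, rface d = f.
Proof.
case=> _ [c [c0 _ _ _] Cf]; case: c c0 Cf => // d c _ Cf.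
have: edge d \in boundary f by rewrite -Cf cycle_edgesE mem_head.
by rewrite boundaryE => /orP[]/eqP; [exists d|exists (flip d)].
Qed.

(** An alternating cell has some sign, and the matching dart on its boundary given by [signed_dart]
    rules out the wrong one. *)
Lemma proper_cellP M f : proper_cell white M f <-> cell f /\ signed white true M f.
Proof.
split=> [[[cf [c [cc Cf alt]]] po]|[cf sf]].
  split=> //; have [[] // sf] := alternating_signed cc Cf alt.
  have [d df] := cell_dart cf; have [e ef /andP[eM /eqP we]] := signed_dart df sf.
  by have [] := po e ef eM; rewrite we.
split.
  split=> //; case: cf => _ [c cc Cf]; exists c; split=> //.
  exact: signed_alternating sf.
by move=> d df; rewrite (sf _ df) /tgt white_flip => /eqP->.
Qed.

Lemma improper_cellP M f : improper_cell white M f <-> cell f /\ signed white false M f.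
Proof.
split=> [[[cf [c [cc Cf alt]]] po]|[cf sf]].
  split=> //; have [[] // sf] := alternating_signed cc Cf alt.
  by case: po => d df; rewrite (sf _ df) /tgt white_flip => /eqP->.
split.
  split=> //; case: cf => _ [c cc Cf]; exists c; split=> //.
  exact: signed_alternating sf.
have [d df] := cell_dart cf; have [e ef /andP[eM /eqP we]] := signed_dart df sf.
by move=> /(_ e ef eM); rewrite we => -[].
Qed.

(* The flux through [d] is larger by one in [N] than in [M]. *)
Definition diffdart M N d :=
  ((edge d \in M) != white (src d)) && ((edge d \in N) == white (src d)).

(** Such a dart is the [N]-edge at a white vertex and the [M]-edge at a black one, so it is unique
    at its source. *)
Lemma diffdart_uniq M N d d' : perfect_matching M -> perfect_matching N ->
  diffdart M N d -> diffdart M N d' -> src d = src d' -> d = d'.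
Proof.
move=> pmM pmN /andP[dM dN] /andP[dM' dN'] e.
have [w|b] := boolP (white (src d)).
  by apply: (matching_uniq whiteP pmN e); rewrite ?(eqP dN) ?(eqP dN') -?e.
apply: (matching_uniq whiteP pmM e).
  by move: dM; rewrite (negbTE b); case: (_ \in _).
by move: dM'; rewrite -e (negbTE b); case: (_ \in _).
Qed.

(** Exactly one of the matchings contains the edge of [d]; the edge of the other one at the head of
    [d] continues the walk. *)
Lemma diffdart_succ M N d : perfect_matching M -> perfect_matching N ->
  diffdart M N d -> exists2 e, diffdart M N e & src e = tgt d.
Proof.
move=> pmM pmN /andP[dM dN].
have [w|b] := boolP (white (tgt d)).
  have [e se eN] := matching_ex whiteP (tgt d) pmN; exists e => //.
  rewrite /diffdart eN se w /= andbT; apply/negP => /eqP eM.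
  have dM' : edge (flip d) \in M.
    by move: w dM; rewrite edge_flip /tgt white_flip => /negbTE->; case: (_ \in _).
  have ed : e = flip d by apply: (matching_uniq whiteP pmM).
  by move: w dN eN; rewrite ed edge_flip /tgt white_flip => /negbTE -> /eqP ->.
have [e se eM] := matching_ex whiteP (tgt d) pmM; exists e => //.
rewrite /diffdart eM se (negbTE b) /=; apply/negP => eN.
have {}eN : edge e \in N by move: eN; case: (_ \in _).
have wd : white (src d) by move: b; rewrite /tgt white_flip negbK.
have dN' : edge (flip d) \in N by rewrite edge_flip (eqP dN).
have ed : e = flip d by apply: (matching_uniq whiteP pmN).
by move: dM eM; rewrite ed edge_flip wd => /negP nM eM; apply: nM; rewrite eM.
Qed.

Lemma diffdart_flip M N d : diffdart M N d -> ~~ diffdart M N (flip d).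
Proof. by rewrite /diffdart edge_flip white_flip; do 2!case: (_ \in _); case: (white _). Qed.

(** The component of the symmetric difference through [d0], as the orbit of a successor map.
    Uniqueness of matching edges at the heads makes the map injective, so the orbit closes up at
    [d0]. *)
Lemma diffdart_cycle M N d0 : perfect_matching M -> perfect_matching N ->
  diffdart M N d0 -> exists c,
    [/\ is_cycle c, d0 \in c, forall d, d \in c -> diffdart M N d & alternating M c].
Proof.
move=> pmM pmN dd0.
(* The default [d] only makes [succ] total; on difference darts [diffdart_succ] provides a
   successor. *)
pose succ d := odflt d [pick e | diffdart M N e && (src e == tgt d)].
have succP d : diffdart M N d -> diffdart M N (succ d) /\ src (succ d) = tgt d.
  move=> dd; rewrite /succ; case: pickP => [e /andP[de /eqP se] //|no].
  by have [e de se] := diffdart_succ pmM pmN dd; have := no e; rewrite de se eqxx.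
have closed : {homo succ : d / d \in diffdart M N} by move=> d /succP[].
have inj : {in diffdart M N &, injective succ}.
  move=> d d' dd dd' e; have [_ s1] := succP d dd; have [_ s2] := succP d' dd'.
  have et : src (flip d) = src (flip d') by rewrite -[LHS]s1 e s2.
  apply: (@flip_inj G).
  have ew : white (src d) = white (src d') by apply: negb_inj; rewrite -!white_flip et.
  move: (dd) (dd') => /andP[dM dN] /andP[dM' dN'].
  have [w|b] := boolP (white (src d)).
    by apply: (matching_uniq whiteP pmN et); rewrite edge_flip ?(eqP dN) ?(eqP dN') -?ew.
  apply: (matching_uniq whiteP pmM et); rewrite edge_flip.
    by move: dM; rewrite (negbTE b); case: (_ \in _).
  by move: dM'; rewrite -ew (negbTE b); case: (_ \in _).
pose c := fingraph.orbit succ d0; have d0c : d0 \in c by apply: in_orbit.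
have fc : fcycle succ c by apply: (cycle_orbit_in closed inj).
have cdd d : d \in c -> diffdart M N d.
  rewrite -fconnect_orbit => /iter_findex <-.
  by elim: (findex _ _ _) => //= n; apply: closed.
have nE d : d \in c -> next c d = succ d by move=> dc; apply/esym/eqP/(next_cycle fc dc).
have cc : is_cycle c.
  split.
  - by move: d0c; case: (c).
  - have ac : all [in c] c by apply/allP.
    apply: sub_in_cycle ac fc.
    by move=> d d' dc _ /= /eqP<-; have [_ ->] := succP d (cdd d dc).
  - rewrite map_inj_in_uniq ?orbit_uniq // => d d' dc d'c.
    exact: (diffdart_uniq pmM pmN (cdd _ dc) (cdd _ d'c)).
  rewrite map_inj_in_uniq ?orbit_uniq // => d d' dc d'c /eqP.
  rewrite edge_eq => /orP[]/eqP // e.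
  by have := diffdart_flip (cdd _ d'c); rewrite -e cdd.
exists c; split=> // d dc; rewrite nE //; have [ds ss] := succP d (cdd d dc).
move: (cdd d dc) ds; rewrite /diffdart ss /tgt white_flip.
by do 2!case: (_ \in M); case: (white _); rewrite ?andbF.
Qed.

End Cycles.

(** * Regions *)

Section Regions.
Variables (G : drawing) (white : pred (vertex G)).
Hypotheses (planarG : planar G) (whiteP : proper_coloring white).
Implicit Types (d : dart G) (v : vertex G) (f g : face G).
Implicit Types (M N H : {set {set dart G}}) (c : seq (dart G)) (s : bool) (A : {set face G}).
Local Open Scope ring_scope.

Let white_flip := white_flip whiteP.

(* Equivalently, adding the indicator of [A] to the potential of [M] gives the
   potential of another perfect matching. *)
Definition region M A : bool :=
  [forall d, (rface d \in A) && (rface (flip d) \notin A) ==>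
             ((edge d \in M) != white (src d))].

Lemma regionP M A : reflect
  (forall d, rface d \in A -> rface (flip d) \notin A -> (edge d \in M) != white (src d))
  (region M A).
Proof.
apply: (iffP forallP) => [r d dA fdA | r d]; first by have := r d; rewrite dA fdA.
by apply/implyP => /andP[]; apply: r.
Qed.

(** A flux that can still be raised is not maximal, and it is maximal exactly when membership in [M]
    agrees with the source being white. *)
Lemma compat_lt M N h d : compat white M N h -> h (rface (flip d)) < h (rface d) ->
  (edge d \in M) != white (src d).
Proof.
by move=> /(_ d); rewrite /flux /sg; case: (white _); do 2!case: (_ \in _) => //=; lia.
Qed.

Lemma region_threshold M A (h : face G -> int) t : region M A ->
  (forall d, h (rface (flip d)) < h (rface d) -> (edge d \in M) != white (src d)) ->
  region M (A :&: [set f | t <= h f]).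
Proof.
move=> /regionP rA hM; apply/regionP => d; rewrite !inE => /andP[dA td].
rewrite negb_and -ltNge => /orP[|th]; first exact: rA.
exact/hM/(lt_le_trans th).
Qed.

Definition min_region M := minset (fun A => [&& A != set0, outer G \notin A & region M A]).

(** Cutting [A] at the level [h a] leaves a nonempty region, so nothing is cut off. The hypothesis
    on [h] holds for potentials of matchings and also for those of cycles made of difference
    darts. *)
Lemma min_region_const M A (h : face G -> int) : min_region M A ->
  (forall d, h (rface (flip d)) < h (rface d) -> (edge d \in M) != white (src d)) ->
  {in A &, forall a b, h a = h b}.
Proof.
move=> /minsetP[/and3P[A0 oA rA] minA] hM.
suff le a b : a \in A -> b \in A -> h a <= h b.
  by move=> a b aA bA; apply/eqP; rewrite eq_le !le.
move=> aA bA; have: A :&: [set f | h a <= h f] = A.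
  apply: minA; last exact: subsetIl.
  rewrite (region_threshold _ rA hM) !inE (negbTE oA) !andbT.
  by apply/set0Pn; exists a; rewrite !inE aA lexx.
by move/setP/(_ b); rewrite !inE bA.
Qed.

Lemma min_region_interior M N A d : perfect_matching M -> perfect_matching N ->
  min_region M A -> rface d \in A -> rface (flip d) \in A ->
  (edge d \in N) = (edge d \in M).
Proof.
move=> pmM pmN mA dA fdA; have [h [_ hE]] := matching_potential planarG whiteP pmM pmN.
have := hE d; rewrite (min_region_const mA _ dA fdA) => [|e]; last exact: compat_lt.
by rewrite subrr /flux /sg; case: (white _); do 2!case: (_ \in _).
Qed.

Lemma face_has_dart f : f != outer G -> exists d, rface d = f.
Proof.
move=> fo; have /connectP[[|y p] /=] := planarG.1 (inr f) (inr (outer G)).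
  by move=> _ [e]; rewrite e eqxx in fo.
by case: y => [v|g] //= /andP[/existsP[d /andP[_ /eqP df]] _] _; exists d.
Qed.

Lemma outer_has_dart (d : dart G) : exists d, rface d = outer G.
Proof.
have /connectP[[|y p] //=] := planarG.1 (inr (outer G)) (inl (src d)).
by case: y => [v|g] //= /andP[/existsP[e /andP[_ /eqP ef]] _] _; exists e.
Qed.

(* The potential of one boundary cycle [c] of [f] takes the value [h f - 1] at
   every corner reachable from [c] and not in [f]; so connectedness leaves no
   room for a second boundary cycle. *)
Lemma signed_face_cell M f : perfect_matching M -> f != outer G ->
  signed white false M f ->
  (forall d d', rface d = f -> rface d' = f -> connect (adj (edges G)) (src d) (src d')) ->
  cell f.
Proof.
move=> pmM fo sf conn; split=> //.
have [d0 d0f] := face_has_dart fo.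
pose N := symdiff M (boundary f).
have pmN : perfect_matching N by apply: matching_flip_face sf.
have NE d : edge d \in boundary f -> (edge d \in N) = (edge d \notin M).
  by move=> df; rewrite mem_symdiff df addbT.
have sfN d : rface d = f -> diffdart white M N d.
  move=> df; have dB : edge d \in boundary f by rewrite boundaryE df eqxx.
  by rewrite /diffdart NE // (sf _ df); case: (white _).
have [c [cc d0c cN _]] := diffdart_cycle whiteP pmM pmN (sfN _ d0f).
have cf d : d \in c -> rface d = f.
  move=> /cN dd; have [//|n1] := eqVneq (rface d) f.
  have [/sfN df|n2] := eqVneq (rface (flip d)) f.
    by have := diffdart_flip whiteP df; rewrite flipK dd.
  move: dd; rewrite /diffdart mem_symdiff boundaryE (negbTE n1) (negbTE n2) addbF.
  by case: (_ \in _); case: (white _).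
have uc := is_cycle_uniq cc; have inj := is_cycle_src_inj cc.
have [h [_ hE]] := cycle_potential planarG whiteP cc.
pose good v := forall e, src e = v -> e \in c \/ h (rface e) = h f - 1.
have good_on x : x \in c -> good (src x).
  move=> xc; pose p := prev c x.
  have pc : p \in c by rewrite mem_prev.
  have xp : x = next c p by rewrite /p next_prev.
  (* The dart following [p] on the boundary of [f] is a difference dart with the same source as [x],
     hence is [x]. *)
  have xccw : x = ccw G (flip p).
    apply: (diffdart_uniq whiteP pmM pmN (cN _ xc)); last by rewrite src_ccw xp src_next.
    by apply: sfN; rewrite rfaceP cf.
  suff H e : src e = src x -> e = x \/ h (rface e) = h f - 1.
    by move=> e /H[->|]; [left|right].
  (* Rotating away from [x] crosses [x], where the potential drops by one; it keeps this value until
     the rotation reaches [flip p], whose successor is [x] again. *)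
  apply: (@ccw_ind G (fun e => e = x \/ h (rface e) = h f - 1)) => [|{}e se [->|he]]; first by left.
    right; rewrite rface_ccw; have := hE x; rewrite xc (negbTE (cycle_flipN cc xc)) (cf _ xc); lia.
  have [->|ep] := eqVneq e (flip p); first by left.
  right; rewrite rface_ccw; have := hE e.
  have -> : (e \in c) = false by apply/negP => /cf ef; move: he; rewrite ef; lia.
  have -> : (flip e \in c) = false.
    apply: contraNF ep => ec; rewrite -(inj_eq (@flip_inj G)) flipK; apply/eqP.
    apply: (can_inj (prev_next uc)); rewrite -xp.
    by apply: inj; rewrite ?mem_next // src_next // tgt_flip.
  lia.
have good_step e : good (src e) -> good (tgt e).
  move=> ge; have [/hasP[x xc /eqP<-]|no] := boolP (has (fun x => src x == tgt e) c).
    exact: good_on.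
  have {}no x : src x = tgt e -> (x \notin c) && (flip x \notin c).
    move=> sx; apply/andP; split; apply/negP => xc; case/hasP: no.
      by exists x; rewrite ?sx.
    by exists (next c (flip x)); rewrite ?mem_next // src_next // tgt_flip sx.
  move=> x sx; right.
  apply: (@ccw_ind G (fun x => h (rface x) = h f - 1) (flip e)) => // [|y sy hy].
    have /andP[] := no (flip e) erefl; rewrite flipK => fec ec.
    have [ec'|<-] := ge e erefl; first by rewrite ec' in ec.
    by have := hE e; rewrite (negbTE ec) (negbTE fec); lia.
  have /andP[yc fyc] := no y sy.
  by have := hE y; rewrite (negbTE yc) (negbTE fyc) rface_ccw; lia.
have good_conn v : connect (adj (edges G)) (src d0) v -> good v.
  case/connectP => p; have := good_on _ d0c.
  elim: p (src d0) => [|y p IHp] x gx /=; first by move=> _ ->.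
  case/andP=> /existsP[e /and3P[_ /eqP ex /eqP ey]]; apply: IHp.
  by rewrite -ey; apply: good_step; rewrite ex.
exists c => //; apply/setP => x; apply/idP/idP.
  by rewrite inE => /mapP[d dc ->]; rewrite boundaryE cf ?eqxx.
case/imsetP => d; rewrite inE => /eqP df ->; rewrite cycle_edgesE.
by have [-> //|] := good_conn _ (conn _ _ d0f df) d erefl; rewrite df; lia.
Qed.

(** If [d] is not matched, a matching containing it is used. Otherwise connectedness and the second
    edge [d0] give another edge meeting [d], and a matching containing that edge avoids [d]. *)
Lemma elementary_toggle W H M d d0 : elementary_sub W H ->
  (forall e, edge e \in H -> src e \in W) ->
  edge d \in H -> edge d0 \in H -> edge d0 != edge d ->
  exists2 N, perfect_matching_of W H N & (edge d \in N) != (edge d \in M).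
Proof.
move=> [conn mat] HW dH d0H ne.
have [dM|dM] := boolP (edge d \in M); last first.
  by have [N pmN dN] := mat _ dH; exists N; rewrite // dN.
have tW e : edge e \in H -> tgt e \in W by rewrite -edge_flip => /HW.
pose Q := pred2 (src d) (tgt d).
case: (pickP (fun e => [&& edge e \in H, edge e != edge d & Q (src e)])) => [e|no].
  case/and3P=> eH ned se; have [N pmN eN] := mat _ eH; exists N => //.
  rewrite eqb_id; apply/negP => dN; case/eqP: ned.
  apply: (matching_of_uniq (v := src e) pmN); rewrite ?mem_ends ?eqxx ?HW //.
(* Without such an edge the two ends of [d] would form a whole component. *)
have H2 v : connect (adj H) (src d) v -> Q v.
  case/connectP => p; have: Q (src d) by rewrite /= eqxx.
  elim: p (src d) => [|y p IHp] x Qx /=; first by move=> _ ->.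
  case/andP=> /existsP[e /and3P[eH /eqP ex /eqP ey]]; apply: IHp.
  have := no e; rewrite eH ex Qx andbT => /negbFE.
  by rewrite edge_eq -ey /Q => /orP[]/eqP-> /=; rewrite ?tgt_flip eqxx ?orbT.
by have := no d0; rewrite d0H ne H2 // conn ?HW.
Qed.

End Regions.

(** * Frontiers of regions, discs of alternating cycles, and existence of improper cells *)

Section Weak.
Variables (G : drawing) (white : pred (vertex G)).
Hypotheses (planarG : planar G) (whiteP : proper_coloring white).
Implicit Types (d : dart G) (v : vertex G) (f g : face G).
Implicit Types (M N H : {set {set dart G}}) (c : seq (dart G)) (s : bool) (A : {set face G}).
Local Open Scope ring_scope.

Let white_flip := white_flip whiteP.

Definition frontier A : {set {set dart G}} :=
  [set edge d | d : dart G & (rface d \in A) && (rface (flip d) \notin A)].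

Lemma frontierE A d : (edge d \in frontier A) = (rface d \in A) (+) (rface (flip d) \in A).
Proof.
apply/imsetP/idP => [[e]|].
  rewrite inE => /andP[eA feA] /eqP; rewrite edge_eq => /orP[]/eqP->; rewrite ?flipK eA.
    exact: feA.
  by rewrite (negbTE feA).
case dA: (rface d \in A); case fdA: (rface (flip d) \in A) => //= _.
  by exists d; rewrite ?inE ?dA ?fdA.
by exists (flip d); rewrite ?edge_flip ?inE ?flipK ?dA ?fdA.
Qed.

Lemma frontier_sub A : frontier A \subset edges G.
Proof. by apply/subsetP => _ /imsetP[d _ ->]; apply: edge_in_edges. Qed.

Lemma matching_flip_region M A : perfect_matching M -> region white M A ->
  perfect_matching (symdiff M (frontier A)).
Proof.
move=> pmM /regionP rA.
apply: (@compat_matching G white whiteP M _ (fun f => (f \in A)%:Z)) => //.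
  by apply: sub_symdiff (frontier_sub A); case: pmM.
move=> d; rewrite /flux mem_symdiff frontierE /sg.
have := rA d; have := rA (flip d); rewrite flipK edge_flip white_flip.
case: (rface d \in A); case: (rface (flip d) \in A) => /= r1 r2;
  rewrite ?addbF ?subrr // addbT.
  by have := r2 isT isT; case: (white _); case: (_ \in _).
by have := r1 isT isT; case: (white _); case: (_ \in _).
Qed.

Lemma frontier_diffdart M A d : region white M A ->
  diffdart white M (symdiff M (frontier A)) d = (rface d \in A) && (rface (flip d) \notin A).
Proof.
move=> /regionP rA; rewrite /diffdart mem_symdiff frontierE.
have := rA d; have := rA (flip d); rewrite flipK edge_flip white_flip.
case: (rface d \in A); case: (rface (flip d) \in A) => /= r1 r2;
  rewrite ?addbF ?addbT //=; try by case: (white _); case: (_ \in _).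
  by have := r2 isT isT; case: (white _); case: (_ \in _).
by have := r1 isT isT; case: (white _); case: (_ \in _).
Qed.

Lemma connect_dual_const (B : {set {set dart G}}) (h : face G -> int) f g :
  (forall d, edge d \notin B -> h (rface d) = h (rface (flip d))) ->
  connect (dual_adj B) f g -> h f = h g.
Proof.
move=> hB /connectP[p]; elim: p f => [|y p IHp] x /=; first by move=> _ ->.
by case/andP=> /existsP[d /and3P[dB /eqP<- /eqP dy]] /IHp{}IHp /IHp <-; rewrite hB // dy.
Qed.

(* The frontier cycle through such a dart has [A] in its interior. *)
Lemma outer_frontier_dart A : A != set0 -> outer G \notin A -> exists d,
  [/\ rface d \in A, rface (flip d) \notin A &
      connect (dual_adj (frontier A)) (outer G) (rface (flip d))].
Proof.
move=> /set0Pn[a aA] oA; set R := connect _.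
case: (pickP (fun d => [&& rface d \in A, rface (flip d) \notin A &
                           R (outer G) (rface (flip d))])).
  by move=> d /and3P[]; exists d.
move=> no; have [|d [cd dA]|_] := @face_ind G planarG (fun f => R (outer G) f /\ f \notin A) _ _ a.
- by rewrite /R connect0.
- have fdA : rface (flip d) \notin A.
    by apply/negP => fdA; have := no (flip d); rewrite flipK fdA dA cd.
  split=> //; apply: (connect_trans cd); apply: connect1.
  by apply/existsP; exists d; rewrite frontierE (negbTE dA) (negbTE fdA) !eqxx.
by rewrite aA.
Qed.

(** At each vertex of [c] one of the two cycle edges is matched, and no other edge of [M] meets that
    vertex. *)
Lemma alternating_matched M c d e : perfect_matching M -> is_cycle c -> alternating M c ->
  src d = src e -> edge d \in cycle_edges c -> edge e \in M -> edge e \in cycle_edges c.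
Proof.
move=> pmM cc alt sde dC eM; have uc := is_cycle_uniq cc.
have [z zc sz] : exists2 z, z \in c & src z = src e.
  move: dC; rewrite cycle_edgesE => /orP[dc|dc]; first by exists d.
  by exists (next c (flip d)); rewrite ?mem_next // src_next // tgt_flip.
have pc : prev c z \in c by rewrite mem_prev.
have := alt _ pc; rewrite next_prev //.
have [zM _|zM /esym/negbFE pM] := boolP (edge z \in M).
  by rewrite cycle_edgesE -(matching_uniq whiteP pmM sz zM eM) zc.
have sp : src (flip (prev c z)) = src e.
  by rewrite -[src (flip _)](src_next cc pc) next_prev.
rewrite cycle_edgesE -(matching_uniq whiteP pmM sp _ eM) ?edge_flip //.
by rewrite flipK pc orbT.
Qed.

Lemma cycle_edges_sub c : cycle_edges c \subset edges G.
Proof. by apply/subsetP => e; rewrite inE => /mapP[d _ ->]; apply: edge_in_edges. Qed.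

Lemma alternating_nice M c : perfect_matching M -> is_cycle c -> alternating M c -> nice c.
Proof.
move=> pmM cc alt; set C := cycle_edges c; set W := ~: verts C.
have sC := cycle_edges_sub c.
have sM : M \subset edges G by case: pmM.
exists [set e in M | ends e \subset W]; split.
  apply/subsetP => e; rewrite !inE => /andP[eM ->]; rewrite andbT.
  exact: (subsetP sM).
move=> v vW; case: (pmM) => _ /(_ v (in_setT v)) <-.
apply: eq_card => e; rewrite !inE; case eM: (e \in M) => //=.
case ve: (v \in ends e); rewrite ?andbF // andbT.
apply/subsetP => u ue; rewrite inE; apply/negP => /(vertsP _ sC)[y yu yC].
have [x De] := edge_of sM eM.
have [z zu ze] : exists2 z, src z = u & edge z = e.
  move: ue; rewrite De mem_ends => /orP[]/eqP->; first by exists x.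
  by exists (flip x); rewrite ?edge_flip.
have zC : edge z \in C by apply: (alternating_matched pmM cc alt _ yC); rewrite ?ze ?yu.
by move: vW; rewrite inE => /negP[]; apply/bigcupP; exists e; rewrite // -ze.
Qed.

Lemma insideE c d : inside (cycle_edges c) (rface d) -> edge d \notin cycle_edges c ->
  inside (cycle_edges c) (rface (flip d)).
Proof.
move=> ins dC; apply: contra ins => co; apply: (connect_trans co); apply: connect1.
by apply/existsP; exists (flip d); rewrite edge_flip dC flipK !eqxx.
Qed.

Lemma disc_edgesE c d : (edge d \in disc_edges c) =
  [|| edge d \in cycle_edges c, inside (cycle_edges c) (rface d) |
      inside (cycle_edges c) (rface (flip d))].
Proof.
rewrite /disc_edges in_setU; congr (_ || _); apply/imsetP/orP => [[e]|[di|di]].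
- by rewrite inE => ei /eqP; rewrite edge_eq => /orP[]/eqP->; rewrite ?flipK; [left|right].
- by exists d; rewrite ?inE.
by exists (flip d); rewrite ?edge_flip ?inE.
Qed.

Lemma disc_edges_sub c : disc_edges c \subset edges G.
Proof.
rewrite subUset cycle_edges_sub; apply/subsetP => _ /imsetP[d _ ->].
exact: edge_in_edges.
Qed.

(** At a vertex of [c] the matching edge is on [c]. At any other vertex no edge belongs to [c], so
    as soon as one face around it is inside, all of them are. *)
Lemma disc_matched M c d e : perfect_matching M -> is_cycle c -> alternating M c ->
  src d = src e -> edge d \in disc_edges c -> edge e \in M -> edge e \in disc_edges c.
Proof.
move=> pmM cc alt sde dH eM; set C := cycle_edges c.
case: (pickP (fun y => (src y == src e) && (edge y \in C))) => [y /andP[/eqP ye yC]|no].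
  by rewrite disc_edgesE (alternating_matched pmM cc alt ye yC eM).
have {}no y : src y = src e -> edge y \notin C.
  by move=> ye; have := no y; rewrite ye eqxx /= => ->.
have di : inside C (rface d).
  move: dH; rewrite disc_edgesE (negbTE (no d sde)) /= => /orP[] // fdi.
  by rewrite -[d]flipK; apply: (insideE fdi); rewrite edge_flip no.
rewrite disc_edgesE; apply/orP; right; apply/orP; left.
apply: (@ccw_ind G (fun x => inside C (rface x)) d) => // x sx xi.
by rewrite rface_ccw; apply: (insideE xi); rewrite no // sx.
Qed.

(** By [disc_matched] the edges of [M] at vertices of the disc lie in the disc, so [N] covers these
    vertices and the rest of [M] covers the others. *)
Lemma extend_disc_matching M N c : perfect_matching M -> is_cycle c -> alternating M c ->
  perfect_matching_of (verts (disc_edges c)) (disc_edges c) N ->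
  perfect_matching (N :|: (M :\: disc_edges c)).
Proof.
move=> pmM cc alt [sN N1]; set H := disc_edges c in sN N1 *.
have sH := disc_edges_sub c; have sM : M \subset edges G by case: pmM.
split.
  by rewrite subUset (subset_trans sN sH) (subset_trans (subsetDl _ _) sM).
move=> v _; have [vW|vW] := boolP (v \in verts H).
  have vH e : e \in M -> v \in ends e -> e \in H.
    have /(vertsP _ sH)[y yv yH] := vW.
    move=> eM; have [x De] := edge_of sM eM; move: eM.
    rewrite De mem_ends => xM /orP[]/eqP vx.
      exact: (disc_matched pmM cc alt (etrans yv vx) yH).
    rewrite -edge_flip; apply: (disc_matched pmM cc alt (etrans yv vx) yH).
    by rewrite edge_flip.
  rewrite -(N1 v vW); apply: eq_card => e; rewrite in_set in_setU in_setD [RHS]in_set.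
  case eN: (e \in N) => //=; apply/negP => /andP[/andP[eH eM] ve].
  by rewrite vH in eH.
case: (pmM) => _ /(_ v (in_setT v)) <-; apply: eq_card => e.
rewrite in_set in_setU in_setD [RHS]in_set.
case ve: (v \in ends e); rewrite ?andbF // !andbT.
have eH : e \notin H by apply: contra vW => eH; apply/bigcupP; exists e.
by rewrite eH (contraNF (subsetP sN e) eH).
Qed.

(** What both hypotheses on [G] provide: the first clause excludes interior edges of a minimal
    region, the second puts the boundary of a face in one component, as [signed_face_cell]
    requires. *)
Definition locally_elementary M A : Prop :=
  (forall d, rface d \in A -> rface (flip d) \in A ->
     exists2 N, perfect_matching N & (edge d \in N) != (edge d \in M)) /\
  (forall d d', rface d \in A -> rface d' \in A -> connect (adj (edges G)) (src d) (src d')).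

(** Minimality makes the potential of a frontier cycle [c] through an outermost dart constant on
    [A], so [A] lies inside [c]. Being alternating, [c] is nice, so its disc is elementary, and
    matchings of the disc extend by [M]. *)
Lemma weakly_elementary_local M A : weakly_elementary G -> perfect_matching M ->
  min_region white M A -> locally_elementary M A.
Proof.
move=> weakG pmM mA; have /minsetP[/and3P[A0 oA rA] _] := mA.
pose N := symdiff M (frontier A); have pmN : perfect_matching N by apply: matching_flip_region.
have [d0 [d0A fd0A od0]] := outer_frontier_dart A0 oA.
have [|c [cc d0c cN alt]] := diffdart_cycle (d0 := d0) whiteP pmM pmN.
  by rewrite /N frontier_diffdart // d0A.
have cA d : d \in c -> (rface d \in A) && (rface (flip d) \notin A).
  by move=> /cN; rewrite /N frontier_diffdart.
have [h [ho hE]] := cycle_potential planarG whiteP cc.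
have h0 d : d \notin c -> flip d \notin c -> h (rface d) = h (rface (flip d)).
  by move=> dc fdc; have := hE d; rewrite (negbTE dc) (negbTE fdc); lia.
(* The face on the left of [d0] is joined to the outer face without crossing the frontier, hence
   without crossing [c]; so [h] vanishes there and rises by one across [d0]. *)
have hd0 : h (rface d0) = 1.
  have: h (outer G) = h (rface (flip d0)).
    apply: connect_dual_const od0 => d; rewrite frontierE => dA.
    by apply: h0; apply: contra dA => /cA; rewrite ?flipK => /andP[-> /negbTE->].
  have := hE d0; rewrite d0c (negbTE (cycle_flipN cc d0c)); lia.
have hA a : a \in A -> h a = 1.
  move=> aA; rewrite -hd0; apply: (min_region_const mA _ aA d0A) => d lt.
  suff /cN /andP[] : d \in c by [].
  by have := hE d; case: (d \in c) => //; lia.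
set C := cycle_edges c.
have iA a : a \in A -> inside C a.
  move=> aA; apply/negP => co; have := hA a aA; rewrite -(connect_dual_const _ co) ?ho //.
  by move=> d; rewrite cycle_edgesE negb_or => /andP[]; apply: h0.
have [conn mat] := weakG c cc (alternating_nice pmM cc alt).
have sH := disc_edges_sub c.
have AH d : rface d \in A -> edge d \in disc_edges c.
  by move=> /iA dA; rewrite disc_edgesE dA orbT.
have HW d : edge d \in disc_edges c -> src d \in verts (disc_edges c).
  by move=> dH; apply/(vertsP _ sH); exists d.
split=> [d dA fdA|d d' dA d'A]; last first.
  have := conn _ _ (HW _ (AH _ dA)) (HW _ (AH _ d'A)).
  apply: connect_sub => x y /existsP[e /and3P[_ ex ey]]; apply: connect1.
  by apply/existsP; exists e; rewrite edge_in_edges ex.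
have [||N0 pmN0 N0M] :=
  @elementary_toggle G _ _ M d d0 (conj conn mat) HW (AH _ dA).
- by rewrite disc_edgesE cycle_edgesE d0c.
- rewrite edge_eq; apply/negP => /orP[]/eqP e; move: fd0A; rewrite e ?flipK ?dA ?fdA //.
exists (N0 :|: (M :\: disc_edges c)); first exact: extend_disc_matching.
by rewrite in_setU in_setD (AH _ dA) /= orbF.
Qed.

Lemma elementary_local M A : elementary G -> outer G \notin A -> locally_elementary M A.
Proof.
move=> elG oA; split=> [d dA fdA|d d' _ _]; last by apply: elG.1; rewrite inE.
(* Both sides of [d] lie in [A] and the outer face does not, so a dart along the outer face belongs
   to another edge. *)
have [d0 d0o] := outer_has_dart planarG d.
apply: (elementary_toggle (d0 := d0) _ elG); rewrite ?edge_in_edges //.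
rewrite edge_eq; apply/negP => /orP[]/eqP e; move: oA; rewrite -d0o e ?dA ?fdA //.
Qed.

Lemma region_improper_cell M A : elementary G \/ weakly_elementary G ->
  perfect_matching M -> A != set0 -> outer G \notin A -> region white M A ->
  exists2 f, f \in A & improper_cell white M f.
Proof.
move=> elG pmM A0 oA rA; pose P A := [&& A != set0, outer G \notin A & region white M A].
have [|B mB BA] := @minset_exists _ P A; first by rewrite /P A0 oA.
have /minsetP[/and3P[/set0Pn[f fB] oB /regionP rB] _] := mB.
have [tog conn] : locally_elementary M B.
  by case: elG => elG; [apply: elementary_local|apply: weakly_elementary_local].
exists f; first exact: (subsetP BA).
have sf : signed white false M f.
  move=> d df; have dB : rface d \in B by rewrite df.
  (* On the frontier the region condition is the wanted sign. An interior edge is impossible: [tog]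
     changes it, while minimality fixes it in every perfect matching. *)
  have [fdB|/(rB d dB)] := boolP (rface (flip d) \in B); last by case: (_ \in _); case: (white _).
  have [N pmN] := tog d dB fdB.
  by rewrite (min_region_interior planarG whiteP pmM pmN mB) // eqxx.
apply/(improper_cellP planarG whiteP); split=> //.
apply: (signed_face_cell planarG whiteP pmM _ sf); first by apply: contraNneq oB => <-.
by move=> d d' df d'f; apply: conn; rewrite ?df ?d'f.
Qed.

End Weak.

(** * The order on perfect matchings *)

Section Lattice.
Variables (G : drawing) (white : pred (vertex G)).
Hypotheses (planarG : planar G) (whiteP : proper_coloring white).
Implicit Types (d : dart G) (v : vertex G) (f g : face G).
Implicit Types (M N K : {set {set dart G}}).
Local Open Scope ring_scope.

Lemma symdiff_eq M N (B : {set {set dart G}}) : symdiff M N = B -> N = symdiff M B.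
Proof.
move=> <-; apply/setP => e; rewrite !mem_symdiff.
by do 2!case: (_ \in _).
Qed.

Lemma symdiffKl M (B : {set {set dart G}}) : symdiff M (symdiff M B) = B.
Proof. by apply/setP => e; rewrite !mem_symdiff; do 2!case: (_ \in _). Qed.

Lemma proper_flip M f : proper_cell white M f -> improper_cell white (symdiff M (boundary f)) f.
Proof.
move=> /(proper_cellP planarG whiteP)[cf sf].
by apply/(improper_cellP planarG whiteP); split=> //; apply: signed_flip_face sf.
Qed.

Lemma improper_flip M f : improper_cell white M f -> proper_cell white (symdiff M (boundary f)) f.
Proof.
move=> /(improper_cellP planarG whiteP)[cf sf].
by apply/(proper_cellP planarG whiteP); split=> //; apply: signed_flip_face sf.
Qed.

Lemma proper_matching_flip M f : perfect_matching M -> proper_cell white M f ->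
  perfect_matching (symdiff M (boundary f)).
Proof. by move=> pmM /(proper_cellP planarG whiteP)[_]; apply: matching_flip_face. Qed.

Lemma improper_matching_flip M f : perfect_matching M -> improper_cell white M f ->
  perfect_matching (symdiff M (boundary f)).
Proof. by move=> pmM /(improper_cellP planarG whiteP)[_]; apply: matching_flip_face. Qed.

Lemma Zarc_up M f : perfect_matching M -> improper_cell white M f ->
  Zarc white (symdiff M (boundary f)) M.
Proof.
move=> pmM imf; split=> //; first exact: improper_matching_flip.
exists f; first exact: improper_flip.
by apply/setP => e; rewrite !mem_symdiff; do 2!case: (_ \in _).
Qed.

Lemma Zarc_inv M N : Zarc white M N ->
  exists2 f, improper_cell white N f & M = symdiff N (boundary f).
Proof.
case=> pmM pmN [f pf /symdiff_eq NE]; exists f; last by rewrite NE symdiffK.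
by rewrite NE; apply: proper_flip.
Qed.

Lemma Zarc_compat M N : Zarc white M N ->
  exists2 f, f != outer G & compat white N M (fun g => (g == f)%:Z).
Proof.
case/Zarc_inv => f /(improper_cellP planarG whiteP)[[fo _] sf] ->.
exists f => // d; rewrite (compat_flip_face whiteP sf).
by rewrite !mul1r.
Qed.

Lemma compat0 M : compat white M M (fun=> 0).
Proof. by move=> d; rewrite !subrr. Qed.

Lemma compatD M N K h k : compat white M N h -> compat white N K k ->
  compat white M K (fun f => h f + k f).
Proof. by move=> c1 c2 d; have := c1 d; have := c2 d; lia. Qed.

Lemma compatN M N h : compat white M N h -> compat white N M (fun f => - h f).
Proof. by move=> c1 d; have := c1 d; lia. Qed.

Lemma compat_uniq M N h k : compat white M N h -> compat white M N k ->
  h (outer G) = 0 -> k (outer G) = 0 -> h =1 k.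
Proof.
move=> ch ck h0 k0 f; apply/eqP; rewrite -subr_eq0; apply/eqP.
rewrite (potential_const planarG (h := fun f => h f - k f)) ?h0 ?k0 // => d.
by have := ch d; have := ck d; lia.
Qed.

Lemma compat_eq M N h : perfect_matching M -> perfect_matching N ->
  compat white M N h -> (forall f, h f = 0) -> M = N.
Proof.
move=> [sM _] [sN _] c h0; apply: (flux_inj (white := white)) => // d.
by have := c d; rewrite !h0 subrr => /eqP; rewrite subr_eq0 => /eqP.
Qed.

Lemma matching_le_compat M N : matching_le white M N ->
  exists h, [/\ forall f, 0 <= h f, h (outer G) = 0 & compat white M N h].
Proof.
rewrite /matching_le; elim=> [x y /Zarc_compat[f fo c]|x|x y z _ [h [h0 ho ch]] _ [k [k0 ko ck]]].
- exists (fun g => (g == f)%:Z); split=> //; by rewrite eq_sym (negbTE fo).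
- by exists (fun=> 0); split=> //; apply: compat0.
exists (fun f => k f + h f); split; last exact: compatD ck ch.
  by move=> f; rewrite addr_ge0.
by rewrite ho ko.
Qed.

Lemma Zarc_neq M N : Zarc white M N -> N <> M.
Proof.
case/Zarc_compat => f fo c e; rewrite e in c.
have := compat_uniq c (compat0 M) _ erefl f; rewrite eqxx => H.
by have: (1 : int) = 0 by apply: H; rewrite eq_sym (negbTE fo).
Qed.

(** Otherwise the potentials around a closed walk would add up to zero, although all are nonnegative
    and the arc contributes one at its cell. *)
Lemma matching_le_Zarc M N : Zarc white M N -> ~ matching_le white M N.
Proof.
move=> /Zarc_compat[f fo c] /matching_le_compat[h [h0 ho ch]].
have := compat_uniq (compatD c ch) (compat0 N) _ erefl f; rewrite eqxx ho eq_sym (negbTE fo) addr0.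
by move=> /(_ erefl); have := h0 f; lia.
Qed.

(** The first arc of a path from [M] to [N] already ends at [N], by the covering condition.
    Conversely the indicator of one face is not a sum of two nonzero nonnegative integer
    potentials. *)
Lemma covered_byP M N : covered_by white N M <-> Zarc white M N.
Proof.
split=> [[pmN pmM leNM neq cov]|arc].
  have r := clos_rt_rt1n _ _ _ _ leNM.
  move: pmN {leNM} neq cov; case: N / r => // K L arc r _ _ cov; have KL := clos_rt1n_rt _ _ _ _ r.
  have pmK : perfect_matching K by case: arc.
  case: (cov K pmK KL) => [|<- //|e]; first exact: rt_step.
  by case: (Zarc_neq arc).
have [pmM pmN _] := arc; split=> //; first exact: rt_step.
  exact: Zarc_neq.
move=> K pmK /matching_le_compat[h [h0 ho ch]] /matching_le_compat[k [k0 ko ck]].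
have [f fo c] := Zarc_compat arc.
have E g : h g + k g = (g == f)%:Z.
  by apply: (compat_uniq (compatD ch ck) c); rewrite ?ho ?ko // eq_sym (negbTE fo).
have [hf|hf] := eqVneq (h f) 0.
  left; apply/esym/(compat_eq pmN pmK ch) => g; have := E g.
  have [->|_ /=] := eqVneq g f; first by rewrite hf.
  by have := h0 g; have := k0 g; lia.
right; apply: (compat_eq pmK pmM ck) => g; have := E g; have := h0 g; have := k0 g.
have [->|_ /=] := eqVneq g f; last by lia.
by move: hf => /eqP hf /=; lia.
Qed.

(** * The top matching, meet-irreducible cells and the hypercube *)

Hypothesis elemG : elementary G \/ weakly_elementary G.

(** The level set [1 <= h] is a nonempty region without the outer face, and such a region contains
    an improper cell. *)
Lemma compat_improper M N h f : perfect_matching M -> compat white M N h ->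
  h (outer G) = 0 -> 0 < h f -> exists2 g, 0 < h g & improper_cell white M g.
Proof.
move=> pmM c h0 hf.
have rA : region white M [set g | 1 <= h g].
  rewrite -[[set g | _]]setTI; apply: region_threshold => [|d].
    by apply/regionP => d _; rewrite inE.
  exact: (compat_lt c).
have [||g] := region_improper_cell planarG whiteP elemG pmM _ _ rA.
- by apply/set0Pn; exists f; rewrite inE.
- by rewrite inE h0.
by rewrite inE => hg img; exists g.
Qed.

(** Were the potential [h] of [M] relative to [N] negative somewhere, [M] would have an improper
    cell; so [h] is nonnegative. Unless it vanishes, [N] has an improper cell on which [h] is
    positive; reversing it climbs one arc and lowers the sum of [h] by one. *)
Lemma no_improper_top M : perfect_matching M ->
  ~ (exists g, improper_cell white M g) -> top_matching white M.
Proof.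
move=> pmM noM; split=> // N pmN.
have [h [h0 ch]] := matching_potential planarG whiteP pmN pmM.
have [n] := ubnP `|(\sum_f h f)%R|%N; elim: n N pmN h h0 ch => // n IHn N pmN h h0 ch lt.
have hge f : 0 <= h f.
  rewrite leNgt; apply/negP => hf; case: noM.
  have [||g _ img] := compat_improper (f := f) pmM (compatN ch); [by rewrite h0| |by exists g].
  by rewrite oppr_gt0.
have [/existsP[f hf]|all0] := boolP [exists f, 0 < h f]; last first.
  rewrite (compat_eq pmN pmM ch); first exact: rt_refl.
  move=> f; apply/eqP; rewrite eq_le hge andbT leNgt.
  by apply: contra all0 => hf; apply/existsP; exists f.
have [g hg img] := compat_improper pmN ch h0 hf.
have arc := Zarc_up pmN img; have pmN1 := improper_matching_flip pmN img.
apply: rt_trans (rt_step _ _ _ _ arc).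
have [[go _] sf] := (improper_cellP planarG whiteP N g).1 img.
pose k f := h f - (f == g)%:Z.
apply: (IHn _ pmN1 k).
- by rewrite /k h0 eq_sym (negbTE go).
- by move=> d; have := ch d; have := compat_flip_face whiteP sf d; rewrite !mul1r /k; lia.
have -> : \sum_f k f = \sum_f h f - 1.
  rewrite sumrB; congr (_ - _); rewrite (bigD1 g) //= eqxx big1 ?addr0 //.
  by move=> i /negbTE->.
have : 0 < \sum_f h f.
  rewrite (bigD1 g) //=; apply: ltr_pwDl => //; exact: sumr_ge0.
lia.
Qed.

Lemma top_no_improper M : top_matching white M -> ~ exists g, improper_cell white M g.
Proof.
move=> [pmM topM] [g img]; have arc := Zarc_up pmM img.
exact: (matching_le_Zarc arc) (topM _ (improper_matching_flip pmM img)).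
Qed.

Lemma improper_disjoint M g h : perfect_matching M ->
  improper_cell white M g -> improper_cell white M h -> g <> h -> ~ share_vertex g h.
Proof.
move=> pmM /(improper_cellP planarG whiteP)[_ sg] /(improper_cellP planarG whiteP)[_ sh] ne sgh.
by apply: ne; apply: (signed_share_eq whiteP pmM sg sh sgh).
Qed.

Lemma improper_flip_disjoint M f g : ~ share_vertex f g ->
  improper_cell white M g -> improper_cell white (symdiff M (boundary f)) g.
Proof.
move=> nfg /(improper_cellP planarG whiteP)[cg sg]; apply/(improper_cellP planarG whiteP).
by split=> //; apply: signed_disjoint.
Qed.

Lemma share_vertexC f g : share_vertex f g -> share_vertex g f.
Proof. by case=> v [? ?]; exists v. Qed.

(** With [N] obtained from [M] by reversing [f], every cover of [N] reverses an improper [N]-cell,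
    and [f] gives [M]. By [improper_flip_disjoint], used in both directions, the other ones are the
    improper [M]-cells disjoint from [f]. *)
Lemma meet_irreducible_cellP M f : perfect_matching M -> proper_cell white M f ->
  (meet_irreducible_cell white M f <->
     forall g, improper_cell white M g -> share_vertex f g).
Proof.
move=> pmM pf; pose N := symdiff M (boundary f).
have pmN : perfect_matching N by apply: proper_matching_flip.
have imf : improper_cell white N f := proper_flip pf.
have NM : symdiff N (boundary f) = M by rewrite symdiffK.
have arcM : Zarc white M N by rewrite -{1}NM; apply: Zarc_up.
split=> [[_ [_ [K [_ uniK]]]] g img|share].
  have [// | nfg] := share_vertexP f g.
  have imgN := improper_flip_disjoint nfg img.
  have := uniK _ ((covered_byP _ _).2 (Zarc_up pmN imgN)).
  rewrite (uniK _ ((covered_byP _ _).2 arcM)) => MN.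
  have Bfg : boundary f = boundary g by rewrite -(symdiffKl N (boundary g)) -MN -/N -NM symdiffKl.
  have [d dg] := cell_dart ((improper_cellP planarG whiteP M g).1 img).1.
  case: nfg; exists (src d); rewrite Bfg.
  by split; apply/boundary_vertP; exists d.
split=> //; split=> //; exists M; split; first exact/covered_byP.
move=> K /covered_byP/Zarc_inv[g imgN ->].
have [->|/eqP ne] := eqVneq g f; first by rewrite symdiffK.
have nfg : ~ share_vertex f g by apply: improper_disjoint imf imgN _ => // e; apply: ne.
by case: (nfg); apply: share; rewrite -NM; apply: improper_flip_disjoint.
Qed.

(** Reversing the cells of [S] makes each [g] in [S] proper for [M']; if [f] is proper too and
    shares a vertex with [g], then [f = g], although their signs under [M] differ. Conversely a cell
    [g] disjoint from [f] gives [S = [set g]]. *)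
Lemma hypercubeP M f : perfect_matching M -> proper_cell white M f ->
  ((forall g, improper_cell white M g -> share_vertex f g) <->
   ~ exists M', [/\ improper_hypercube white M M', M' <> M & proper_cell white M' f]).
Proof.
move=> pmM pf; have [cf sf] := (proper_cellP planarG whiteP M f).1 pf.
split=> [share [M' [[S imS ->] neq pf']]|no g img].
  have [S0|[g gS]] := set_0Vmem S.
    by apply: neq; rewrite S0 big_set0; apply/setP => e; rewrite mem_symdiff inE addbF.
  have img := imS g gS; have [cg sg] := (improper_cellP planarG whiteP M g).1 img.
  have sS x : x \in S -> signed white false M x by move/imS/(improper_cellP planarG whiteP) => -[].
  have pmM' := matching_flip_faces whiteP pmM sS.
  have [_ sf'] := (proper_cellP planarG whiteP _ f).1 pf'.
  have e := signed_share_eq whiteP pmM' sf' (signed_flip_faces gS sg) (share g img).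
  have [d dg] := cell_dart cg.
  by have := sg d dg; rewrite (sf d) ?e //; case: (white _).
have [// | nfg] := share_vertexP f g; case: no.
exists (symdiff M (boundary g)); split.
- exists [set g]; last by rewrite big_set1.
  by move=> x; rewrite inE => /eqP->.
- by move=> e; apply: (Zarc_neq (Zarc_up pmM img)).
apply/(proper_cellP planarG whiteP); split=> //.
by apply: signed_disjoint sf => /share_vertexC.
Qed.

End Lattice.

Theorem theorem3p3 (G : drawing) (white : pred (vertex G))
    (planarG : planar G)
    (white_proper : proper_coloring white)
    (elemG : elementary G \/ weakly_elementary G)
    (M : {set {set dart G}}) (matchM : perfect_matching M)
    (f : face G) (proper_f : proper_cell white M f) :
  (((~ exists g, improper_cell white M g) <-> top_matching white M) /\
   ((~ exists g, improper_cell white M g) ->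
      forall g, proper_cell white M g -> meet_irreducible_cell white M g))
  /\
  ((exists g, improper_cell white M g) ->
     (forall g h, improper_cell white M g -> improper_cell white M h ->
        g <> h -> ~ share_vertex g h) /\
     (meet_irreducible_cell white M f <->
        forall g, improper_cell white M g -> share_vertex f g) /\
     (meet_irreducible_cell white M f <->
        ~ exists M', [/\ improper_hypercube white M M', M' <> M &
                         proper_cell white M' f])).
Proof.
have irrP := meet_irreducible_cellP planarG white_proper matchM.
split; first split.
- split; first exact: no_improper_top.
  exact: top_no_improper.
- by move=> no g pg; apply/(irrP g pg) => h imh; case: no; exists h.
move=> _; split=> [g h|]; first exact: improper_disjoint.
split; first exact: irrP.
have [i1 i2] := irrP f proper_f.
have [h1 h2] := hypercubeP planarG white_proper matchM proper_f.
by split=> [/i1/h1 | /h2/i2].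
Qed.
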